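(* For every cubic graph $G$, the list normal chromatic index of $G$ satisfies $\chi_{n,l}'(G) \le 10$.
   Context: Graphs are finite and simple; a cubic graph is a $3$-regular graph. A normal edge-coloring of a cubic graph $G$ is a proper edge-coloring such that, for every edge $e$, the set of colors appearing on the edges adjacent to $e$ has exactly four elements (then $e$ is called rich) or exactly two elements (then $e$ is called poor). A list assignment $L$ for $G$ assigns to each edge $e$ of $G$ a list (set) $L(e)$ of possible colors. The list normal chromatic index $\chi_{n,l}'(G)$ is the least $k$ such that, for every list assignment $L$ with $|L(e)|\ge k$ for every $e\in E(G)$, there is a normal edge-coloring $\varphi$ of $G$ with $\varphi(e)\in L(e)$ for every $e\in E(G)$. *)

(* Defs.v *)
From mathcomp Require Import all_boot.
From mathcomp Require Import finmap.

Set Implicit Arguments.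
Unset Strict Implicit.
Unset Printing Implicit Defensive.

Local Open Scope fset_scope.

Record sgraph := SGraph {
  vertex :> finType;
  adj : rel vertex;
  adj_sym : symmetric adj;
  adj_irrefl : irreflexive adj }.

Definition cubic (G : sgraph) : Prop :=
  forall v : G, #|[set w | adj v w]| = 3.

Definition edge_set (G : sgraph) : {set {set G}} :=
  [set e | [exists v, [exists w, adj v w && (e == [set v; w])]]].

(* Colorings are functions on this subtype rather than on {set G}: when G has
   no edge, a coloring must exist even if the type of colors is empty. *)
Definition edge (G : sgraph) := {e : {set G} | e \in edge_set G}.

Definition edge_adjacent (G : sgraph) (e f : edge G) : bool :=
  (e != f) && (val e :&: val f != set0)%SET.

Section Colorings.
Variables (G : sgraph) (C : choiceType).

Definition proper_edge_coloring (phi : edge G -> C) : Prop :=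
  forall e f : edge G, edge_adjacent e f -> phi e != phi f.

Definition adjacent_colors (phi : edge G -> C) (e : edge G) : {fset C} :=
  [fset phi f | f in [set f : edge G | edge_adjacent e f]%SET].

Definition rich (phi : edge G -> C) (e : edge G) : bool :=
  #|` adjacent_colors phi e| == 4.

Definition poor (phi : edge G -> C) (e : edge G) : bool :=
  #|` adjacent_colors phi e| == 2.

Definition normal_edge_coloring (phi : edge G -> C) : Prop :=
  proper_edge_coloring phi /\ forall e : edge G, rich phi e || poor phi e.

End Colorings.

Definition normally_choosable (G : sgraph) (k : nat) : Prop :=
  forall (C : choiceType) (L : edge G -> {fset C}),
    (forall e, k <= #|` L e|) ->
    exists phi : edge G -> C,
      normal_edge_coloring phi /\ forall e, phi e \in L e.

(* The least such k is given as a relation, since its existence is part of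
   what has to be proved. *)
Definition is_list_normal_chromatic_index (G : sgraph) (k : nat) : Prop :=
  normally_choosable G k /\
  forall j : nat, normally_choosable G j -> k <= j.

(* Main.v *)
Require Import Defs.
From mathcomp Require Import all_boot.
From mathcomp Require Import finmap.
From mathcomp Require Import all_order all_algebra zify.
From Stdlib Require Import Classical_Prop.

(** Call two edges in conflict when they share a vertex or are joined by an edge.
If conflicting edges always get different colours, then the four edges
adjacent to an edge are coloured differently, so that every edge is rich
([strong_normal]). The proof finds such a colouring from lists of size 10,
separately in each connected component ([color_connected]).

The vertices around an edge number at most four, and each is on three edges, so an
edge conflicts with at most twelve others. Inside the component, pick an
induced cycle c_0, ..., c_(n-1), the rim, with spokes c_i x_i, and colour the
edges that miss it from the farthest to the nearest ([greedy_outside]). When such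
an edge is coloured, one of the vertices around it is closer to the rim than
every vertex covered so far; its three edges are still uncoloured, so at most
nine colours are forbidden, and a list of size 10 suffices.

There remain the n rim edges and the n spokes, each with the colours of its
list that no edge off the rim has taken: in general at least 4 for a spoke and
6 for a rim edge, and more when spokes share an end or are joined by
an edge ([room], [seen_room]). Greedy colouring is too weak here, and the
theorem of Alon and Tarsi takes over ([alon_tarsi]): if the coefficient of x^D
in the product of the differences x_u - x_v over all conflicts is not zero, then
lists with more than D_u colours at each u suffice.

What conflicts occur depends on the cycle. A shortest cycle of the component is
induced, and for n >= 7 its minimality makes the spokes independent, so that the
conflict graph is a fixed circulant-like graph with 2n vertices. Its
coefficient is computed for all n at once by sweeping along the cycle: the
partial results depend only on a window of seven vertices, and they become
constant when the exponents are periodic ([tcirc_stationary]). Shortest cycles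
of length 3 to 6 are finitely many cases, each with an explicit exponent D. In
one of these cases, a 4-cycle with two opposite spokes that are joined by an edge, the
rim is a 5-cycle instead ([five_cycle]). *)

Set Implicit Arguments.
Unset Strict Implicit.
Unset Printing Implicit Defensive.
Import GRing.Theory Num.Theory.

(** * Colourings from a nonzero coefficient *)

Section AlonTarsi.
Local Open Scope ring_scope.

(** The coefficient of x^D in x^k times the product of x_u - x_v over the pairs
(u, v) of [es], exponents being lists of naturals. Equivalently, the
signed number of orientations of [es] with prescribed outdegrees D - k. *)
Fixpoint orient (es : seq (nat * nat)) (D k : seq nat) : int :=
  if es is (u, v) :: es' then
    orient es' D (incr_nth k u) - orient es' D (incr_nth k v)
  else (k == D)%:R.

Lemma sumn_incr_nth (s : seq nat) i : sumn (incr_nth s i) = (sumn s).+1.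
Proof.
elim: s i => [|x s IH] [|i] //=; last by rewrite IH addnS.
by rewrite sumn_ncons mul0n.
Qed.

(** Any d + 1 of the points carry weights that extract the top coefficient of a
polynomial of degree at most d, because their Vandermonde matrix is
invertible; the other points get weight 0. *)
Lemma dual_weights (J : finType) (F : fieldType) (io : J -> F) (S : {set J}) d :
  injective io -> (d < #|S|)%N ->
  exists w : J -> F, forall k, (k <= d)%N ->
    \sum_(x in S) w x * io x ^+ k = (k == d)%:R.
Proof.
move=> io_inj dS.
pose pt (j : 'I_d.+1) : J := enum_val (widen_ord dS j).
have pt_inj : injective pt by move=> i j /enum_val_inj /(congr1 val) /= /val_inj.
pose a : 'rV[F]_d.+1 := \row_j io (pt j).
pose V := Vandermonde d.+1 a.
have VU : V \in unitmx.
  rewrite unitmxE det_Vandermonde unitfE; apply/prodf_neq0 => i _.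
  apply/prodf_neq0 => j ij; rewrite !mxE subr_eq0.
  apply/negP => /eqP /io_inj /pt_inj E; by rewrite E ltnn in ij.
pose u : 'cV[F]_d.+1 := invmx V *m \col_i (i == ord_max)%:R.
exists (fun x => \sum_(j | pt j == x) u j 0) => k kd.
have -> : \sum_(x in S) (\sum_(j | pt j == x) u j 0) * io x ^+ k
        = \sum_j u j 0 * io (pt j) ^+ k.
  rewrite [RHS](partition_big pt (fun x => x \in S)) /=; last first.
    by move=> j _; apply: enum_valP.
  apply: eq_bigr => x _; rewrite mulr_suml; apply: eq_bigr => j /eqP <- //.
have := congr1 (fun M : 'cV[F]__ => M (Ordinal (kd : k < d.+1)%N) 0)
  (mulKVmx VU (\col_i (i == ord_max)%:R)).
rewrite !mxE => E; transitivity (\sum_j V (Ordinal (kd : k < d.+1)%N) j * u j 0).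
  by apply: eq_bigr => j _; rewrite !mxE mulrC.
by rewrite E.
Qed.

Variables (N : nat) (J : finType).

(** Sum the product of the differences over the grid of all choices from the
sets S_i, with the weights of [dual_weights] for D_i in coordinate i. The
product is homogeneous of degree |D|, so each monomial other than x^D has an
exponent below D in some coordinate and is killed there; the sum is therefore the
coefficient of x^D. If it is not zero, then some choice from the grid has
a nonzero product. *)
Lemma alon_tarsi (es : seq (nat * nat)) (D : seq nat) (S : 'I_N -> {set J}) :
  size D = N -> all (fun e => (e.1 < N)%N && (e.2 < N)%N) es ->
  (forall i : 'I_N, (nth 0 D i < #|S i|)%N) ->
  orient es D (nseq N 0%N) != 0 ->
  exists f : {ffun 'I_N -> J}, (forall i, f i \in S i) /\
    forall i j : 'I_N, (val i, val j) \in es -> f i != f j.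
Proof.
move=> sD esN SD or0.
pose io (x : J) : rat := (enum_rank x)%:R.
have io_inj : injective io.
  by move=> x y /eqP; rewrite eqr_nat => /eqP /val_inj /enum_rank_inj.
have [w wP] := fin_all_exists (fun i => dual_weights io_inj (SD i)).
(* The value of x_v under f; the default 0 is for v outside the range only. *)
pose ev (f : {ffun 'I_N -> J}) v := if insub v is Some i then io (f i) else 0.
have evE f (i : 'I_N) : ev f i = io (f i) by rewrite /ev valK.
pose mon (f : {ffun 'I_N -> J}) k := \prod_i (w i (f i) * io (f i) ^+ nth 0%N k i).
have monS f k v : (v < N)%N -> mon f (incr_nth k v) = ev f v * mon f k.
  move=> vN; rewrite /mon (bigD1 (Ordinal vN)) //= [in RHS](bigD1 (Ordinal vN)) //=.
  rewrite nth_incr_nth eqxx exprS (evE f (Ordinal vN)).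
  rewrite [in RHS]mulrA [in RHS](mulrCA (io _)) -!mulrA; congr (_ * (_ * (_ * _))).
  apply: eq_bigr => i ni; rewrite nth_incr_nth.
  by case: eqP => // E; case/eqP: ni; apply: val_inj.
have key es' : all (fun e => (e.1 < N)%N && (e.2 < N)%N) es' -> forall k, size k = N ->
    (size es' + sumn k = sumn D)%N ->
    \sum_(f | f \in family S) mon f k * \prod_(e <- es') (ev f e.1 - ev f e.2)
    = (orient es' D k)%:~R.
  elim: es' => [|[u v] es' IH] /=.
    (* For the empty product the sum factors over the coordinates. *)
    move=> _ k sk sumk.
    under eq_bigr => f _ do rewrite big_nil mulr1.
    rewrite -(bigA_distr_big_dep _ (fun i x => w i x * io x ^+ nth 0%N k i)) /=.
    case: eqP => [->|kD].
      by apply: big1 => i _; rewrite wP ?eqxx.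
    have [i ki] : exists i : 'I_N, (nth 0 k i < nth 0 D i)%N.
      apply/existsP; apply: contra_notT kD; rewrite negb_exists => /forallP kD.
      have {}kD i : (nth 0 D i <= nth 0 k i)%N.
        case: (ltnP i N) => iN; first by have := kD (Ordinal iN); rewrite -leqNgt.
        by rewrite nth_default ?sD.
      have sum_nth (s : seq nat) : size s = N -> sumn s = (\sum_(i < N) nth 0 s i)%N.
        by move=> <-; rewrite sumnE (big_nth 0%N) big_mkord.
      apply: (@eq_from_nth _ 0%N) => [|i]; first by rewrite sk.
      rewrite sk => iN.
      have : (\sum_(i < N) nth 0 D i == \sum_(i < N) nth 0 k i)%N.
        by rewrite -!sum_nth // -sumk.
      rewrite (leqif_sum (fun i _ => leqif_eq (kD (val i)))).
      by move=> /forallP /(_ (Ordinal iN)) /eqP /= ->.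
    rewrite (bigD1 i) //= wP ?(ltnW ki) // (ltn_eqF ki) mul0r //.
  case/andP=> /andP[uN vN] es'N k sk sumk.
  have szi x : (x < N)%N -> size (incr_nth k x) = N.
    by move=> xN; rewrite size_incr_nth sk xN.
  have sui x : sumn (incr_nth k x) = (sumn k).+1 by rewrite sumn_incr_nth.
  rewrite rmorphB /= -!IH ?szi ?sui ?addnS //.
  rewrite -sumrB; apply: eq_bigr => f _; rewrite !monS // big_cons /=.
  by rewrite mulrCA mulrBl !mulrA.
(* Each pair raises the exponent by one, so a nonzero coefficient fixes the degree. *)
have sumE : (size es + sumn (nseq N 0) = sumn D)%N.
  have gen es' k : orient es' D k != 0 -> (size es' + sumn k)%N = sumn D.
    elim: es' k => [|[u v] es' IH] k /=; first by case: (k =P D) => [->|_]; rewrite ?eqxx.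
    move=> H; have [Hu|Hu] := eqVneq (orient es' D (incr_nth k u)) 0.
      rewrite Hu sub0r oppr_eq0 in H.
      by have := IH _ H; rewrite sumn_incr_nth addnS.
    by have := IH _ Hu; rewrite sumn_incr_nth addnS.
  exact: gen or0.
have := key es esN (nseq N 0%N) (size_nseq _ _) sumE.
move=> E.
have : \sum_(f | f \in family S) mon f (nseq N 0%N) * \prod_(e <- es) (ev f e.1 - ev f e.2) != 0.
  by rewrite E intr_eq0.
case: (boolP [exists f : {ffun 'I_N -> J},
  (f \in family S) && (\prod_(e <- es) (ev f e.1 - ev f e.2) != 0)]).
  case/existsP=> f /andP[/familyP fS prf] _; exists f; split => // i j ij.
  apply: contraNneq prf => fij.
  rewrite (big_rem _ ij) /= !evE fij subrr mul0r //.
rewrite negb_exists => /forallP H; rewrite big1 ?eqxx // => f fS.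
by have := H f; rewrite fS /= negbK => /eqP ->; rewrite mulr0.
Qed.
End AlonTarsi.

(** * Computing coefficients by sweeping over the vertices *)

(** Polynomials as sorted lists of exponents with coefficients. The pairs are
multiplied in one by one, and monomials that can no longer reach x^D are
dropped at once, which keeps the lists short enough to compute with. *)
Definition table := seq (seq nat * int).

Fixpoint lexlt (k l : seq nat) : bool :=
  match k, l with
  | x :: k', y :: l' => (x < y) || (x == y) && lexlt k' l'
  | _, _ => false
  end.

(** Both arguments sorted, the sum is a merge. Cancelled monomials are
removed, so the final table has a single entry when the coefficient is nonzero. *)
Fixpoint tadd (s : table) : table -> table :=
  fix tadd_s (t : table) : table :=
  match s, t with
  | [::], _ => t
  | _, [::] => s
  | (k, a) :: s', (l, b) :: t' =>
    if k == l then
      let c := (a + b)%R in if c == 0 then tadd s' t' else (k, c) :: tadd s' t'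
    else if lexlt k l then (k, a) :: tadd s' t else (l, b) :: tadd_s t'
  end.

(** Multiplication by x_u, up to [sg]. It keeps the table sorted; the monomials whose
exponent at u would exceed the target are dropped. *)
Definition tbump (cap : seq nat) (sg : int -> int) (t : table) u : table :=
  [seq (incr_nth p.1 u, sg p.2) | p <- t & nth 0 p.1 u < nth 0 cap u].

Definition tedge cap v (t : table) w : table :=
  tadd (tbump cap id t v) (tbump cap -%R%R t w).

(** Once all pairs at v have been treated, the exponent at v is final. *)
Definition tfix (cap : seq nat) (t : table) v : table :=
  [seq p <- t | nth 0 p.1 v == nth 0 cap v].

Definition tgroup cap (t : table) (g : nat * seq nat) : table :=
  tfix cap (foldl (tedge cap g.1) t g.2) g.1.

Definition tsweep cap (t : table) (gs : seq (nat * seq nat)) : table :=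
  foldl (tgroup cap) t gs.

Definition group_edges (g : nat * seq nat) : seq (nat * nat) := [seq (g.1, w) | w <- g.2].

Section Orient.
Local Open Scope ring_scope.

Lemma orient_over es D k i : (nth 0 D i < nth 0 k i)%N -> orient es D k = 0.
Proof.
elim: es k => [|[u v] es IH] k /= Dk.
  by case: eqP Dk => [->|//]; rewrite ltnn.
by rewrite !IH ?subr0 // nth_incr_nth (leq_trans Dk) // leq_addl.
Qed.

Definition avoids i (es : seq (nat * nat)) := all (fun e => (e.1 != i) && (e.2 != i)) es.

Lemma orient_settled es D k i :
  avoids i es -> nth 0 k i != nth 0 D i -> orient es D k = 0.
Proof.
elim: es k => [|[u v] es IH] k /=.
  by move=> _; case: (k =P D) => // ->; rewrite eqxx.
by case/andP=> /andP[ui vi] av kD; rewrite !IH ?subr0 // nth_incr_nth ?(negPf ui) ?(negPf vi).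
Qed.

Lemma avoids_cat i es es' : avoids i (es ++ es') = avoids i es && avoids i es'.
Proof. exact: all_cat. Qed.

(** What a table contributes to the coefficient when the pairs [es] are still to be
multiplied in. All operations on tables are justified by leaving this
sum unchanged. The keys are short windows on the exponents, which [emb]
expands to full length. *)
Definition table_orient es D (emb : seq nat -> seq nat) (t : table) : int :=
  \sum_(p <- t) p.2 * orient es D (emb p.1).

Lemma table_orient_nil es D emb : table_orient es D emb [::] = 0.
Proof. exact: big_nil. Qed.

Lemma table_orient_cons es D emb p t :
  table_orient es D emb (p :: t) = p.2 * orient es D (emb p.1) + table_orient es D emb t.
Proof. exact: big_cons. Qed.

Lemma table_orient_add es D emb s t :
  table_orient es D emb (tadd s t) = table_orient es D emb s + table_orient es D emb t.
Proof.
elim: s t => [|[k a] s IHs] t; first by case: t => [|[? ?] ?]; rewrite table_orient_nil add0r.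
elim: t => [|[l b] t IHt]; first by rewrite table_orient_nil addr0.
rewrite /= in IHt; rewrite /=.
case: eqP => [<-|_].
  rewrite !table_orient_cons /= addrACA -mulrDl.
  case: eqP => [->|_]; first by rewrite mul0r add0r IHs.
  by rewrite table_orient_cons IHs.
case: ifP => _; first by rewrite !table_orient_cons IHs table_orient_cons addrA.
by rewrite table_orient_cons IHt !table_orient_cons addrCA.
Qed.

Definition keysize m (t : table) := all (fun p => size p.1 == m) t.

Lemma keysize_add m s t : keysize m s -> keysize m t -> keysize m (tadd s t).
Proof.
elim: s t => [|[k a] s IHs] t; first by case: t => [|[? ?] ?].
elim: t => [|[l b] t IHt] //= /andP[ks ss] /andP[lt tt].
rewrite /= ks ss in IHt.
case: eqP => _; first by case: ifP => _ /=; rewrite ?ks IHs.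
case: ifP => _ /=; first by rewrite ks IHs //= lt tt.
by rewrite lt IHt.
Qed.

(** Coordinate i of a key is coordinate [rho i] of the exponent that it stands for;
[cap] is the part of the target D that the key sees. *)
Section Embedding.
Variables (D cap : seq nat) (m : nat) (emb : seq nat -> seq nat) (rho : nat -> nat).
Hypothesis emb_incr : forall w i, size w = m -> (i < m)%N ->
  emb (incr_nth w i) = incr_nth (emb w) (rho i).
Hypothesis emb_nth : forall w i, size w = m -> (i < m)%N ->
  nth 0%N (emb w) (rho i) = nth 0%N w i.
Hypothesis emb_cap : forall i, (i < m)%N -> nth 0%N D (rho i) = nth 0%N cap i.

Lemma keysize_bump sg t u : (u < m)%N -> keysize m t -> keysize m (tbump cap sg t u).
Proof.
move=> um kt; rewrite /keysize all_map; apply/allP => p.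
rewrite mem_filter => /andP[_] /(allP kt) /eqP pm /=.
by rewrite size_incr_nth pm um.
Qed.

Lemma table_orient_bump sg es t u : (u < m)%N -> keysize m t ->
  table_orient es D emb (tbump cap sg t u)
  = \sum_(p <- t) sg p.2 * orient es D (incr_nth (emb p.1) (rho u)).
Proof.
move=> um kt; rewrite /table_orient big_map big_filter big_mkcond.
apply: eq_big_seq => p /(allP kt) /eqP pm /=.
case: ltnP => [_|over]; first by rewrite emb_incr.
rewrite (@orient_over _ _ _ (rho u)) ?mulr0 //.
by rewrite nth_incr_nth eqxx emb_nth // emb_cap.
Qed.

Lemma table_orient_edge es t u v : (u < m)%N -> (v < m)%N -> keysize m t ->
  table_orient ((rho u, rho v) :: es) D emb t = table_orient es D emb (tedge cap u t v).
Proof.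
move=> um vm kt; rewrite table_orient_add !table_orient_bump // -big_split /=.
by apply: eq_bigr => p _; rewrite mulrBr mulNr.
Qed.

Lemma keysize_edge t u v : (u < m)%N -> (v < m)%N -> keysize m t -> keysize m (tedge cap u t v).
Proof. by move=> um vm kt; apply: keysize_add; apply: keysize_bump. Qed.

Lemma keysize_fix t v : keysize m t -> keysize m (tfix cap t v).
Proof. by move=> kt; apply/allP=> p; rewrite mem_filter => /andP[_] /(allP kt). Qed.

Lemma table_orient_fix es t v : (v < m)%N -> keysize m t -> avoids (rho v) es ->
  table_orient es D emb t = table_orient es D emb (tfix cap t v).
Proof.
move=> vm kt av; rewrite /table_orient big_filter [RHS]big_mkcond.
apply: eq_big_seq => p /(allP kt) /eqP pm; case: ifPn => // kv.
by rewrite (@orient_settled _ _ _ (rho v)) ?mulr0 // emb_nth // emb_cap.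
Qed.

Lemma table_orient_pairs es t l : all (fun e => (e.1 < m) && (e.2 < m))%N l -> keysize m t ->
  let t' := foldl (fun t e => tedge cap e.1 t e.2) t l in
  table_orient ([seq (rho e.1, rho e.2) | e <- l] ++ es) D emb t = table_orient es D emb t' /\
  keysize m t'.
Proof.
elim: l t => [|[u v] l IH] t //= /andP[/andP[um vm] lm] kt.
by rewrite table_orient_edge //; apply: IH => //; apply: keysize_edge.
Qed.

Lemma table_orient_edges es t u ws : (u < m)%N -> all (fun w => w < m)%N ws -> keysize m t ->
  let t' := foldl (tedge cap u) t ws in
  table_orient ([seq (rho u, rho w) | w <- ws] ++ es) D emb t = table_orient es D emb t' /\
  keysize m t'.
Proof.
move=> um wm kt; have lm : all (fun e => (e.1 < m) && (e.2 < m))%N [seq (u, w) | w <- ws].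
  by rewrite all_map /=; apply: sub_all wm => w wm /=; rewrite um.
have := table_orient_pairs es lm kt; rewrite -map_comp /=.
by have -> : foldl (fun t e => tedge cap e.1 t e.2) t [seq (u, w) | w <- ws]
     = foldl (tedge cap u) t ws
  by elim: ws t {kt wm lm} => //=.
Qed.

Lemma table_orient_group es t g : (g.1 < m)%N -> all (fun w => w < m)%N g.2 -> keysize m t ->
  avoids (rho g.1) es ->
  table_orient ([seq (rho g.1, rho w) | w <- g.2] ++ es) D emb t
    = table_orient es D emb (tgroup cap t g) /\
  keysize m (tgroup cap t g).
Proof.
move=> gm wm kt av; have [-> ks] := table_orient_edges es gm wm kt.
by split; [exact: table_orient_fix | exact: keysize_fix].
Qed.

(** After the group of a vertex, that vertex does not occur any more; this is
what allows [tgroup] to fix its exponent. *)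
Fixpoint upward (gs : seq (nat * seq nat)) : bool :=
  if gs is g :: gs' then
    [&& g.1 < m, all (fun w => w < m)%N g.2,
        all (fun h : nat * seq nat => (h.1 != g.1) && (g.1 \notin h.2)) gs' & upward gs']%N
  else true.

Hypothesis rho_inj : {in gtn m &, injective rho}.

(** With all pairs treated, the coefficient is read off the remaining table. *)
Lemma table_orient_sweep t gs : keysize m t -> upward gs ->
  table_orient (flatten [seq [seq (rho g.1, rho w) | w <- g.2] | g <- gs]) D emb t
  = table_orient [::] D emb (tsweep cap t gs).
Proof.
elim: gs t => [|g gs IH] t //= kt /and4P[gm wm fr up].
have av : avoids (rho g.1) (flatten [seq [seq (rho g.1, rho w) | w <- g.2] | g <- gs]).
  elim: gs fr up {IH} => [|h gs IH] //= /andP[/andP[hg gh] fr] /and4P[hm hw _ up].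
  rewrite avoids_cat IH // andbT /avoids all_map; apply/allP => w wh /=.
  have wm' := allP hw _ wh.
  apply/andP; split.
    by apply: contraNneq hg => /(rho_inj hm gm) ->.
  by apply: contraNneq gh => /(rho_inj wm' gm) <-.
have [-> ks] := table_orient_group gm wm kt av.
exact: IH.
Qed.
End Embedding.

End Orient.

Definition later_neighbors (H : rel nat) N v := [seq w <- iota v.+1 (N - v.+1) | H v w].
Definition groups (H : rel nat) N := [seq (v, later_neighbors H N v) | v <- iota 0 N].
Definition constraints (H : rel nat) N := flatten [seq group_edges g | g <- groups H N].

Definition settled (D : seq nat) (t : table) : bool :=
  if t is [:: (k, a)] then (k == D) && (a != 0%R) else false.

Lemma settledP D t : settled D t -> exists2 a, t = [:: (D, a)] & a != 0%R.
Proof. by case: t => [|[k a] [|? ?]] //= /andP[/eqP -> a0]; exists a. Qed.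

(** Decides by computation that the coefficient of x^D for the graph H on the
vertices below N is not zero. *)
Definition certifies N (H : rel nat) (D : seq nat) : bool :=
  (size D == N) && settled D (tsweep D [:: (nseq N 0, 1%R)] (groups H N)).

Lemma upward_groups H N : upward N (groups H N).
Proof.
rewrite /groups.
have gen n v : v + n = N -> upward N [seq (v, later_neighbors H N v) | v <- iota v n].
  elim: n v => [|n IH] v //= vn.
  rewrite IH ?addSnnS // andbT; apply/and3P; split; first by lia.
    by apply/allP => w; rewrite mem_filter mem_iota => /andP[_]; lia.
  apply/allP => g /mapP[u]; rewrite mem_iota => uv -> /=.
  rewrite mem_filter mem_iota; apply/andP; split; first lia.
  by rewrite negb_and; apply/orP; right; lia.
exact: gen.
Qed.

Lemma certifiesP N H D : certifies N H D ->
  size D = N /\ orient (constraints H N) D (nseq N 0) != 0%R.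
Proof.
case/andP => /eqP sD; have ks : keysize N [:: (nseq N 0, 1%R : int)].
  by rewrite /= size_nseq eqxx.
have := @table_orient_sweep D D N id id (fun _ _ _ _ => erefl) (fun _ _ _ _ => erefl)
  (fun _ _ => erefl) (fun _ _ _ _ e => e) _ _ ks (upward_groups H N).
rewrite [in LHS]/table_orient big_cons big_nil /= mul1r addr0 => E.
rewrite -[flatten _]/(constraints H N) in E.
case/settledP => a tE a0; split=> //.
by rewrite E tE table_orient_cons table_orient_nil /= eqxx mulr1 addr0.
Qed.

(** * The coefficient for a long cycle *)

(** An exponent in the middle of a sweep along the cycle: the vertices below v are
finished and have their target exponent, the next b and the last three are
in progress and are listed in the key w, the m in between are untouched. *)
Definition window (D : seq nat) b v m (w : seq nat) :=
  take v D ++ take b w ++ nseq m 0 ++ drop b w.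
Definition place b v m i := if i < b then v + i else v + m + i.

Section Window.
Variables (D : seq nat) (b v m : nat).
Hypothesis szD : size D = v + b + m + 3.

Lemma nth_window w j : size w = b + 3 ->
  nth 0 (window D b v m w) j =
    if j < v then nth 0 D j
    else if j < v + b then nth 0 w (j - v)
    else if j < v + b + m then 0 else nth 0 w (j - v - m).
Proof.
move=> sw; rewrite /window !nth_cat !size_take size_nseq szD sw.
have -> : (v < v + b + m + 3) = true by lia.
have -> : (b < b + 3) = true by lia.
case: (ltnP j v) => jv; first by rewrite nth_take.
case: (ltnP j (v + b)) => jb.
  have -> : j - v < b by lia.
  by rewrite nth_take //; lia.
have -> : (j - v < b) = false by lia.
case: (ltnP j (v + b + m)) => jm.
  have -> : j - v - b < m by lia.
  by rewrite nth_nseq if_same.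
have -> : (j - v - b < m) = false by lia.
by rewrite nth_drop; congr nth; lia.
Qed.

Lemma size_window w : size w = b + 3 -> size (window D b v m w) = size D.
Proof.
by move=> sw; rewrite /window !size_cat size_nseq size_drop !size_takel ?sw ?szD; lia.
Qed.

Lemma window_nth w i : size w = b + 3 -> i < b + 3 ->
  nth 0 (window D b v m w) (place b v m i) = nth 0 w i.
Proof.
move=> sw ib; rewrite nth_window // /place; case: (ltnP i b) => ib'.
  have -> : (v + i < v) = false by lia.
  have -> : (v + i < v + b) by lia.
  by congr nth; lia.
have -> : (v + m + i < v) = false by lia.
have -> : (v + m + i < v + b) = false by lia.
have -> : (v + m + i < v + b + m) = false by lia.
by congr nth; lia.
Qed.

Lemma window_incr w i : size w = b + 3 -> i < b + 3 ->
  window D b v m (incr_nth w i) = incr_nth (window D b v m w) (place b v m i).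
Proof.
move=> sw ib; have pl : place b v m i < size D by rewrite szD /place; case: ifP; lia.
have sw' : size (incr_nth w i) = b + 3 by rewrite size_incr_nth sw ib.
apply: (@eq_from_nth _ 0); first by rewrite size_incr_nth !size_window // pl.
rewrite size_window // => j jD; rewrite nth_incr_nth !nth_window // !nth_incr_nth /place.
rewrite szD in jD; case: (ltnP i b) => ib'; (case: (ltnP j v) => ?; [|
  case: (ltnP j (v + b)) => ?; [|case: (ltnP j (v + b + m)) => ?]]); lia.
Qed.

Lemma window_cap i : i < b + 3 ->
  nth 0 D (place b v m i) = nth 0 (take b (drop v D) ++ drop (size D - 3) D) i.
Proof.
move=> ib; rewrite nth_cat size_takel ?size_drop ?szD; last lia.
rewrite /place; case: ifP => ib'; first by rewrite nth_take // nth_drop.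
by rewrite nth_drop; congr nth; lia.
Qed.
End Window.

(** In a long cycle, with the spoke at c_i labelled 2i and the rim edge from c_i to
c_(i+1) labelled 2i + 1, a spoke conflicts with the next three labels and a
rim edge with the next four, cyclically. *)
Definition reach v := 3 + odd v.
Definition band N v := (v, iota v.+1 (minn (reach v) (N - v.+1))).
Definition band_from N v := flatten [seq group_edges (band N u) | u <- iota v (N - v)].
(** The pairs that close the circle. They involve only the first four and the last
three vertices, so if they are treated first, then a key of seven
exponents is enough during the whole sweep. *)
Definition wrap N := [:: (0, N - 3); (0, N - 2); (0, N - 1); (1, N - 3); (1, N - 2); (1, N - 1);
  (2, N - 1); (3, N - 1)].
Definition circ N := wrap N ++ band_from N 0.

(** The targets of the last three vertices, the same for all lengths considered. *)
Definition tail_degrees := [:: 5; 1; 4].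

(** One step of the sweep: a new vertex enters the window with exponent 0, between
the four vertices in progress and the last three; the pairs from the
first vertex are treated; its exponent is now final and leaves the key. *)
Definition tstep (o : bool) (cap : seq nat) (t : table) : table :=
  [seq (behead p.1, p.2) | p <-
    tgroup cap [seq (take 4 p.1 ++ 0 :: drop 4 p.1, p.2) | p <- t] (0, iota 1 (3 + o))].

(** The parity [o] of the first vertex decides its reach, and [ds] lists the targets from
that vertex on. *)
Fixpoint trun s o (ds : seq nat) (t : table) : table :=
  if s is s'.+1 then trun s' (~~ o) (behead ds) (tstep o (take 5 ds ++ tail_degrees) t) else t.

Lemma keysize_step o cap t : keysize 7 t -> keysize 7 (tstep o cap t).
Proof.
move=> kt.
have k8 : keysize 8 [seq (take 4 p.1 ++ 0 :: drop 4 p.1, p.2) | p <- t].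
  rewrite /keysize all_map; apply/allP => p /(allP kt) /eqP /= sp.
  by rewrite size_cat /= size_drop size_take sp.
suff : keysize 8 (tgroup cap [seq (take 4 p.1 ++ 0 :: drop 4 p.1, p.2) | p <- t]
    (0, iota 1 (3 + o))).
  move=> k8'; rewrite /keysize all_map; apply/allP => p /(allP k8') /eqP /= sp.
  by rewrite size_behead sp.
apply: keysize_fix; have : all (fun w => w < 8) (iota 1 (3 + o)) by case: o.
elim: (iota _ _) [seq _ | p <- t] k8 => [|w ws IH] u //= ku /andP[w8 w8s].
by apply: IH => //; apply: keysize_edge.
Qed.

Lemma band_fromE N v : v < N -> band_from N v = group_edges (band N v) ++ band_from N v.+1.
Proof. by move=> vN; rewrite /band_from -(subnSK vN). Qed.

Lemma band_from_avoids N v u : v < u -> avoids v (band_from N u).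
Proof.
move=> vu; apply/allP => e /flatten_mapP[x]; rewrite mem_iota => xu /mapP[w].
by rewrite /= mem_iota => wx -> /=; lia.
Qed.

(** The key of the new window has one leading entry less, because the entry that is
dropped equals the target by now and [window] restores it from D. *)
Lemma table_orient_step D N v m t :
  size D = N -> N = v + 4 + m.+1 + 3 -> drop (N - 3) D = tail_degrees -> keysize 7 t ->
  table_orient (band_from N v) D (window D 4 v m.+1) t
  = table_orient (band_from N v.+1) D (window D 4 v.+1 m)
      (tstep (odd v) (take 5 (drop v D) ++ tail_degrees) t).
Proof.
move=> sD NE tD kt; have szD : size D = v + 5 + m + 3 by lia.
pose t8 := [seq (take 4 p.1 ++ 0 :: drop 4 p.1, p.2) | p <- t].
have -> : table_orient (band_from N v) D (window D 4 v m.+1) t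
        = table_orient (band_from N v) D (window D 5 v m) t8.
  rewrite /table_orient big_map; apply: eq_big_seq => q /(allP kt) /eqP sp /=.
  congr (_ * orient _ _ _)%R; rewrite /window; congr (_ ++ _).
  by case: q.1 sp => [|a [|b [|c [|d r]]]] //= _; rewrite take0 drop0 /= ?take0 ?drop0.
have k8 : keysize 8 t8.
  rewrite /keysize all_map; apply/allP => p /(allP kt) /eqP /= sp.
  by rewrite size_cat /= size_drop size_take sp.
rewrite band_fromE; last by lia.
have -> : group_edges (band N v) = [seq (place 5 v m 0, place 5 v m w) | w <- iota 1 (3 + odd v)].
  rewrite /group_edges /band /= /reach; have -> : minn (3 + odd v) (N - v.+1) = 3 + odd v by lia.
  by rewrite /place addn0; case: (odd v); rewrite /= ?addn1 ?addn2 ?addn3 ?addn4.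
have cp i : i < 5 + 3 -> nth 0 D (place 5 v m i) = nth 0 (take 5 (drop v D) ++ tail_degrees) i.
  by move=> i8; rewrite (@window_cap D 5 v m) // sD tD.
have wm : all (fun w => w < 8) (iota 1 (3 + odd v)) by case: (odd v).
have av : avoids (place 5 v m 0) (band_from N v.+1).
  by rewrite /place addn0; apply: band_from_avoids.
have [-> ks] := table_orient_group (window_incr szD) (window_nth szD) cp
  (isT : (0, iota 1 (3 + odd v)).1 < 8) wm k8 av.
rewrite /tstep -/t8 [RHS]big_map; apply: eq_big_seq => q pt.
have /eqP sp := allP ks _ pt.
have /eqP p0 : nth 0 q.1 0 == nth 0 (take 5 (drop v D) ++ tail_degrees) 0.
  by move: pt; rewrite mem_filter => /andP[].
congr (_ * orient _ _ _)%R; move: p0; rewrite -cp // /place addn0 /window => p0.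
rewrite [take v.+1 D](take_nth 0) ?sD; last by lia.
rewrite cat_rcons /=; congr (_ ++ _).
by case: q.1 sp p0 => [|a r] //= [sp] ->.
Qed.

Lemma table_orient_run s D N v m t :
  size D = N -> N = v + s + 7 + m -> drop (N - 3) D = tail_degrees -> keysize 7 t ->
  table_orient (band_from N v) D (window D 4 v (s + m)) t
  = table_orient (band_from N (v + s)) D (window D 4 (v + s) m) (trun s (odd v) (drop v D) t).
Proof.
move=> sD; elim: s v t => [|s IH] v t NE tD kt; first by rewrite addn0.
rewrite addSn (@table_orient_step D N) //; last by lia.
rewrite IH //; [|lia|exact: keysize_step].
by rewrite addSnnS /= -drop1 drop_drop add1n.
Qed.

Lemma keysize_run s o ds t : keysize 7 t -> keysize 7 (trun s o ds t).
Proof. by elim: s o ds t => [|s IH] o ds t kt //=; apply/IH/keysize_step. Qed.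

Lemma trun_add s1 s2 o ds t :
  trun (s1 + s2) o ds t = trun s2 (odd s1 (+) o) (drop s1 ds) (trun s1 o ds t).
Proof.
elim: s1 o ds t => [|s1 IH] o ds t /=; first by rewrite drop0.
by rewrite IH /= -drop1 drop_drop addn1 addbN addNb.
Qed.

(** Each step reads five targets, so the last of s steps reads up to number s + 4. *)
Lemma trun_take s l o ds ds' t : s + 4 <= l -> take l ds = take l ds' ->
  trun s o ds t = trun s o ds' t.
Proof.
elim: s l o ds ds' t => [|s IH] [|l] o ds ds' t //= sl E.
have E5 : take 5 ds = take 5 ds'.
  by rewrite -(@take_takel _ 5 l.+1 ds) ?E ?take_takel //; lia.
rewrite E5; apply: (IH l) => //.
by case: ds ds' E {E5} => [|a ds] [|b ds'] //= [].
Qed.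

(** Six targets for the labels of three consecutive vertices of the cycle. Their sum
21 is the number of pairs starting there, and they stay below 4
at spokes and 6 at rim edges. A cycle whose length is not a multiple of 3
starts with one or two copies of [:: 3; 4], of sum 7. *)
Definition period := [:: 3; 5; 3; 5; 1; 4].
Definition circ_degrees r k := flatten (nseq r [:: 3; 4]) ++ flatten (nseq k period).

(** The pairs of [wrap] in terms of the seven positions of a key. *)
Definition wrap_keys :=
  [:: (0, 4); (0, 5); (0, 6); (1, 4); (1, 5); (1, 6); (2, 6); (3, 6)].

Definition twrap (cap : seq nat) : table :=
  foldl (fun t e => tedge cap e.1 t e.2) [:: (nseq 7 0, 1%R)] wrap_keys.

(** The pairs among the last seven vertices. Their first vertex has an odd label,
so the parities are exchanged. *)
Definition lastgroups :=
  [seq (i, iota i.+1 (minn (3 + ~~ odd i) (6 - i))) | i <- iota 0 7].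

(** The sweep around the circle, cut in such a way that only the number of
iterations depends on k: the closing pairs, the 2r irregular labels, k - 2
whole periods, five more steps, and the last seven vertices. A run of one
period reads targets of the next, hence [period ++ period]. *)
Definition tcirc r k : table :=
  let D := circ_degrees r k in
  let t := trun (2 * r) false D (twrap (take 4 D ++ tail_degrees)) in
  let t' := iter (k - 2) (trun 6 false (period ++ period)) t in
  tsweep [:: 4; 3; 5; 3; 5; 1; 4] (trun 5 false (period ++ period) t') lastgroups.

Lemma flatten_nseqD (T : Type) (s : seq T) a c :
  flatten (nseq (a + c) s) = flatten (nseq a s) ++ flatten (nseq c s).
Proof. by rewrite nseqD flatten_cat. Qed.

Lemma size_circ_degrees r k : size (circ_degrees r k) = 2 * r + 6 * k.
Proof. by rewrite size_cat !size_flatten /shape !map_nseq !sumn_nseq. Qed.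

Lemma table_orient_circ r k : 1 < k ->
  let N := 2 * (r + 3 * k) in
  orient (circ N) (circ_degrees r k) (nseq N 0)
  = table_orient [::] (circ_degrees r k) (window (circ_degrees r k) 4 (N - 7) 0) (tcirc r k).
Proof.
move=> k1 N; set D := circ_degrees r k.
have [k' kE] : exists k', k = k' + 2 by exists (k - 2); lia.
have sD : size D = N by rewrite size_circ_degrees /N; lia.
have DE : drop (N - 12) D = period ++ period.
  rewrite /D /circ_degrees kE flatten_nseqD catA drop_size_cat //.
  by rewrite size_cat !size_flatten /shape !map_nseq !sumn_nseq /N kE /=; lia.
have tD : drop (N - 3) D = tail_degrees.
  have -> : N - 3 = 9 + (N - 12) by rewrite /N; lia.
  by rewrite -drop_drop DE.
have NE : N = 0 + 4 + (N - 7) + 3 by rewrite /N; lia.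
have szD0 : size D = 0 + 4 + (N - 7) + 3 by rewrite sD.
pose t0 : table := [:: (nseq 7 0, 1%R)].
have k0 : keysize 7 t0 by [].
have -> : orient (circ N) D (nseq N 0) = table_orient (circ N) D (window D 4 0 (N - 7)) t0.
  rewrite table_orient_cons table_orient_nil addr0.
  rewrite -[(_, _).2]/(1%R : int) mul1r -[(_, _).1]/(nseq 7 0); congr (orient _ _ _).
  rewrite /window take0 cat0s -[take 4 _]/(nseq 4 0) -[drop 4 _]/(nseq 3 0) -!nseqD.
  by congr nseq; lia.
pose cap := take 4 D ++ tail_degrees.
have cp i : i < 4 + 3 -> nth 0 D (place 4 0 (N - 7) i) = nth 0 cap i.
  by move=> i7; rewrite (@window_cap D 4 0 (N - 7)) // drop0 sD tD.
have wm : all (fun e => (e.1 < 4 + 3) && (e.2 < 4 + 3)) wrap_keys by [].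
have [] := table_orient_pairs (window_incr szD0) (window_nth szD0) cp (band_from N 0) wm k0.
rewrite -/(twrap cap) => wE kw.
have -> : circ N = [seq (place 4 0 (N - 7) e.1, place 4 0 (N - 7) e.2)
   | e <- wrap_keys] ++ band_from N 0.
  rewrite /circ /wrap /wrap_keys /place /= !add0n.
  have -> : N - 3 = N - 7 + 4 by lia.
  have -> : N - 2 = N - 7 + 5 by lia.
  by have -> : N - 1 = N - 7 + 6 by lia.
rewrite {}wE; have -> : N - 7 = 2 * r + (6 * k' + 5) + 0 by rewrite /N kE; lia.
rewrite (table_orient_run (N := N)) //; last by rewrite /N kE; lia.
rewrite add0n addn0.
have -> : trun (2 * r + (6 * k' + 5)) (odd 0) (drop 0 D) (twrap cap) =
   trun 5 false (period ++ period)
     (iter (k - 2) (trun 6 false (period ++ period)) (trun (2 * r) false D (twrap cap))).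
  rewrite drop0 trun_add oddM kE addnK -[_ (+) _]/false.
  have -> : drop (2 * r) D = flatten (nseq k' period) ++ period ++ period.
    rewrite /D /circ_degrees drop_size_cat ?size_flatten /shape ?map_nseq ?sumn_nseq //.
    by rewrite kE flatten_nseqD.
  elim: (k') (trun (2 * r) false D (twrap cap)) => [|n IH] t //.
  rewrite iterSr mulnS -addnA trun_add -[_ (+) _]/false -IH.
  congr (trun _ _ _ _); first by rewrite /= drop0.
  by apply: (@trun_take _ 10) => //; case: (n).
have -> : 2 * r + (6 * k' + 5) = N - 7 by rewrite /N kE; lia.
set t' := trun 5 _ _ _; have kt' : keysize 7 t'.
  apply: keysize_run; elim: (k - 2) => [|n IH]; first exact: keysize_run.
  by rewrite iterS; apply: keysize_run.
have szD7 : size D = N - 7 + 4 + 0 + 3 by rewrite sD; lia.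
have cap7 i : i < 4 + 3 -> nth 0 D (place 4 (N - 7) 0 i) = nth 0 [:: 4; 3; 5; 3; 5; 1; 4] i.
  move=> i7; have -> : place 4 (N - 7) 0 i = N - 12 + (5 + i).
    by rewrite /place addn0 if_same /N kE; lia.
  by rewrite -nth_drop DE; move: i i7 => [|[|[|[|[|[|[|]]]]]]].
have pinj : {in gtn (4 + 3) &, injective (place 4 (N - 7) 0)}.
  by move=> i j _ _; rewrite /place addn0 !if_same => /addnI.
have <- := table_orient_sweep (window_incr szD7) (window_nth szD7) cap7 pinj kt'
  (isT : upward 7 lastgroups).
have -> : band_from N (N - 7) = flatten
    [seq [seq (place 4 (N - 7) 0 g.1, place 4 (N - 7) 0 w) | w <- g.2] | g <- lastgroups].
  have pE i : place 4 (N - 7) 0 i = N - 7 + i by rewrite /place addn0 if_same.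
  rewrite /band_from (_ : N - (N - 7) = 7); last by lia.
  rewrite -[X in iota X]addn0 iotaDl -!map_comp; congr flatten.
  apply/eq_in_map => i; rewrite mem_iota => i7 /=.
  rewrite /group_edges /band /reach /= pE (_ : minn _ _ = minn (3 + ~~ odd i) (6 - i)); last first.
    have -> : odd (N - 7 + i) = ~~ odd i by rewrite /N; lia.
    by congr minn; rewrite /N; lia.
  by rewrite -addnS iotaDl -map_comp; apply: eq_map => w /=; rewrite pE.
by rewrite /tcirc.
Qed.

(** The map that sweeps over one period reaches a fixed point after two
rounds, which a computation shows; so the result for every length is that
for k = 4. *)
Lemma tcirc_stationary r n : r < 3 -> tcirc r (n + 4) = tcirc r 4.
Proof.
move=> r3; set F := trun 6 false (period ++ period).
set t := trun (2 * r) false (circ_degrees r 4) (twrap (take 4 (circ_degrees r 4) ++ tail_degrees)).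
have st k : iter (k + 2) F t = iter 2 F t.
  elim: k => [|k IH]; first by [].
  rewrite addSn iterS IH /F /t.
  by case: r r3 {F t IH} => [|[|[|//]]] _; vm_compute.
have pre : take 8 (circ_degrees r (n + 4)) = take 8 (circ_degrees r 4).
  by rewrite /circ_degrees addnC; case: r r3 {F t st} => [|[|[|//]]].
rewrite /tcirc -/F (_ : n + 4 - 2 = n + 2); last by lia.
have tl : 2 * r + 4 <= 8 by lia.
rewrite (trun_take _ _ tl pre).
have -> : take 4 (circ_degrees r (n + 4)) = take 4 (circ_degrees r 4).
  by rewrite -(@take_takel _ 4 8) // pre take_takel.
by rewrite -/t st.
Qed.

Lemma tcirc_settled r k : r < 3 -> 1 < k -> settled [:: 4; 3; 5; 3; 5; 1; 4] (tcirc r k).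
Proof.
move=> r3 k1; have [k4|] := leqP 4 k.
  rewrite -(subnK k4) tcirc_stationary; last by [].
  by case: r r3 => [|[|[|//]]] _; vm_compute.
by case: k k1 => [//|[//|[|[|//]]]] _ _; case: r r3 => [|[|[|//]]] _; vm_compute.
Qed.

Lemma orient_circ r k : r < 3 -> 1 < k ->
  orient (circ (2 * (r + 3 * k))) (circ_degrees r k) (nseq (2 * (r + 3 * k)) 0) != 0%R.
Proof.
move=> r3 k1; rewrite table_orient_circ //; have [a -> a0] := settledP (tcirc_settled r3 k1).
rewrite table_orient_cons table_orient_nil addr0 mulf_neq0 //.
rewrite -[window _ _ _ _ _]/(
  take (2 * (r + 3 * k) - 7) (circ_degrees r k) ++ [:: 4; 3; 5; 3; 5; 1; 4]).
suff -> : [:: 4; 3; 5; 3; 5; 1; 4] = drop (2 * (r + 3 * k) - 7) (circ_degrees r k).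
  by rewrite cat_take_drop /= eqxx.
rewrite -(subnK k1) /circ_degrees flatten_nseqD catA.
rewrite (_ : 2 * _ - 7 = 5 + (size (flatten (nseq r [:: 3; 4]) ++ flatten (nseq (k - 2) period)))).
  by rewrite -drop_drop drop_size_cat.
by rewrite size_cat !size_flatten /shape !map_nseq !sumn_nseq /=; lia.
Qed.

(** * Lists on the edges of the rim *)

Definition choosable N (H : rel nat) (f : nat -> nat) :=
  forall (C : choiceType) (L : 'I_N -> {fset C}),
  (forall i : 'I_N, f i <= #|` L i|%fset) ->
  exists2 phi : 'I_N -> C, (forall i, phi i \in L i) &
    forall i j : 'I_N, i < j -> H i j -> phi i != phi j.

Lemma orient_choosable N es D (H : rel nat) f :
  size D = N -> all (fun e => (e.1 < N) && (e.2 < N)) es ->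
  (forall v, v < N -> nth 0 D v < f v) ->
  (forall v w, v < w -> w < N -> H v w -> (v, w) \in es) ->
  orient es D (nseq N 0) != 0%R -> choosable N H f.
Proof.
move=> sD esN Df Hes or0 C L Lf.
pose A := (\bigcup_(i <- enum 'I_N) L i)%fset.
have LA i c : c \in L i -> c \in A by move=> cL; apply/bigfcupP; exists i; rewrite ?mem_enum.
pose S (i : 'I_N) := [set c : A | val c \in L i].
have SD (i : 'I_N) : nth 0 D i < #|S i|.
  apply: (leq_trans (Df i (ltn_ord i))); apply: (leq_trans (Lf i)).
  rewrite cardE -(size_map val).
  apply: uniq_leq_size; first exact: fset_uniq.
  move=> c cL; apply/mapP; exists [` LA i c cL]%fset => //.
  by rewrite mem_enum inE.
have [g [gS gE]] := alon_tarsi sD esN SD or0.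
exists (fun i => val (g i)) => [i | i j ij Hij].
  by have := gS i; rewrite inE.
by apply: contraNneq (gE i j (Hes _ _ ij (ltn_ord j) Hij)) => /val_inj ->.
Qed.

(** Distance at most one on the cycle of length n. *)
Definition near n i j := [|| i == j, i.+1 %% n == j | j.+1 %% n == i].

(** The conflicts among the 2n edges at the rim, for the labels 2i of the spoke
from c_i and 2i + 1 of the rim edge from c_i to c_(i+1). Here [eq i j] says that
the spokes i and j have the same outer end, [ad i j] that their outer ends are
adjacent. *)
Definition clash n (eq ad : rel nat) v w :=
  let i := v./2 in let j := w./2 in
  match odd v, odd w with
  | true, true => [|| near n i j, near n i (j.+1 %% n) | near n (i.+1 %% n) j]
  | false, true => [|| near n i j, near n i (j.+1 %% n), eq i j | eq i (j.+1 %% n)]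
  | true, false => [|| near n j i, near n j (i.+1 %% n), eq j i | eq j (i.+1 %% n)]
  | false, false => [|| near n i j, eq i j | ad i j]
  end.

(** A lower bound for the colours left at the edges of the rim, see [seen_room].
As i itself is counted by [eq i], it is at least 4 for a spoke and 6 for a rim edge. *)
Definition room n (eq ad : rel nat) v :=
  let i := v./2 in let r k := count (eq k) (iota 0 n) in
  if odd v then 4 + r i + r (i.+1 %% n) else 1 + 3 * r i + count (ad i) (iota 0 n).

Definition fits N (f : nat -> nat) D := all (fun v => nth 0 D v < f v) (iota 0 N).

Lemma nearC n i j : near n i j = near n j i.
Proof. by rewrite /near (eq_sym i j); congr (_ || _); apply: orbC. Qed.

Lemma clash_sub n (eq ad eq' ad' : rel nat) v w :
  (forall i j, i < n -> j < n -> eq i j -> eq' i j) ->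
  (forall i j, i < n -> j < n -> ad i j -> near n i j || ad' i j) ->
  v < 2 * n -> w < 2 * n -> clash n eq ad v w -> clash n eq' ad' v w.
Proof.
move=> He Ha vn wn; rewrite /clash.
have vn' : v./2 < n by lia. have wn' : w./2 < n by lia.
have md k : k %% n < n by rewrite ltn_mod; lia.
case: (odd v); case: (odd w) => //.
- by case/or4P=> [->|->|/He ->|/He ->]; rewrite ?orbT.
- by case/or4P=> [->|->|/He ->|/He ->]; rewrite ?orbT.
- case/or3P=> [->|/He ->|a]; rewrite ?orbT //.
  by case/orP: (Ha _ _ vn' wn' a) => ->; rewrite ?orbT.
Qed.

Lemma room_leq n (eq ad eq' ad' : rel nat) v :
  (forall i j, i < n -> j < n -> eq' i j -> eq i j) ->
  (forall i j, i < n -> j < n -> ad' i j -> ad i j) ->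
  v < 2 * n -> room n eq' ad' v <= room n eq ad v.
Proof.
move=> He Ha vn; have vn' : v./2 < n by lia.
have md k : k %% n < n by rewrite ltn_mod; lia.
have cnt (a a' : rel nat) i : (forall i j, i < n -> j < n -> a' i j -> a i j) -> i < n ->
    count (a' i) (iota 0 n) <= count (a i) (iota 0 n).
  move=> sub ilt; have : forall s, all (gtn n) s -> count (a' i) s <= count (a i) s.
    elim=> [|j s IH] //= /andP[jn /IH]; apply: leq_add.
    by case: (boolP (a' i j)) => // /(sub _ _ ilt jn) ->.
  by apply; apply/allP => j; rewrite mem_iota.
have ce := cnt _ _ _ He; have ca := cnt _ _ _ Ha.
rewrite /room; case: (odd v).
  by apply: leq_add; [rewrite leq_add2l|]; apply: ce.
by apply: leq_add; [rewrite leq_add2l leq_mul2l|]; [apply: ce|apply: ca].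
Qed.

(** The relations [eq] and [ad] need not be known exactly. One computation covers all
the relations between given bounds, if the conflicts are taken from the upper bounds
and the list sizes from the lower ones. *)
Lemma certified_choosable n (eq ad eq_max ad_max eq_min ad_min : rel nat) D :
  (forall i j, i < n -> j < n -> eq i j -> eq_max i j) ->
  (forall i j, i < n -> j < n -> eq_min i j -> eq i j) ->
  (forall i j, i < n -> j < n -> ad i j -> near n i j || ad_max i j) ->
  (forall i j, i < n -> j < n -> ad_min i j -> ad i j) ->
  certifies (2 * n) (clash n eq_max ad_max) D -> fits (2 * n) (room n eq_min ad_min) D ->
  choosable (2 * n) (clash n eq ad) (room n eq ad).
Proof.
move=> eqM eqm adM adm /certifiesP[sD or0] /allP fit.
apply: (orient_choosable sD _ _ _ or0).
- apply/allP => e /flatten_mapP[g /mapP[v]]; rewrite mem_iota => vN -> /mapP[w].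
  by rewrite mem_filter mem_iota => wv -> /=; lia.
- move=> v vN; have vI : v \in iota 0 (2 * n) by rewrite mem_iota.
  apply: (leq_trans (fit v vI)); exact: room_leq.
- move=> v w vw wN cl; apply/flatten_mapP.
  exists (v, later_neighbors (clash n eq_max ad_max) (2 * n) v).
    by apply/mapP; exists v; rewrite // mem_iota; lia.
  apply/mapP; exists w => //; rewrite mem_filter mem_iota; apply/andP; split; last lia.
  by apply: clash_sub cl => //; lia.
Qed.

(** Spokes have at least 4 colours and rim edges at least 6, and all conflicts are
pairs of [circ]; so [orient_circ] applies with r and k from the division
of n by 3. *)
Lemma choosable_long n (eq ad : rel nat) : 6 < n ->
  (forall i j, i < n -> j < n -> eq i j = (i == j)) ->
  (forall i j, i < n -> j < n -> ad i j -> near n i j) ->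
  choosable (2 * n) (clash n eq ad) (room n eq ad).
Proof.
move=> n7 eqE adE.
have [r [k [nE r3 k1]]] : exists r k, [/\ n = r + 3 * k, r < 3 & 1 < k].
  by exists (n %% 3), (n %/ 3); split; rewrite ?ltn_mod //; lia.
have or0 := orient_circ r3 k1; rewrite -nE in or0.
have sD : size (circ_degrees r k) = 2 * n by rewrite size_circ_degrees; lia.
apply: (orient_choosable sD _ _ _ or0).
- rewrite /circ all_cat; apply/andP; split; first by rewrite /wrap /=; apply/and5P; split; lia.
  apply/allP => e /flatten_mapP[v]; rewrite mem_iota => vN /mapP[w].
  by rewrite mem_iota => wv -> /=; lia.
- move=> v vN; apply: leq_trans (_ : (if odd v then 6 else 4) <= _).
    have : forall a, nth 0 (circ_degrees r k) a < if odd a then 6 else 4.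
      have pos s : size s = 2 -> 
         forall t, (forall a, nth 0 t a < if odd a then 6 else 4) ->
         (nth 0 s 0 < 4) -> (nth 0 s 1 < 6) -> forall a, nth 0 (s ++ t) a < if odd a then 6 else 4.
        by case: s => [|x [|y []]] // _ t Ht x4 y6 [|[|a]] //=; rewrite negbK; apply: Ht.
      rewrite /circ_degrees; elim: r {nE r3 or0 sD} => [|r' IH] a; last by apply: (pos [:: 3; 4]).
      elim: {k1} k a => [|k' IH] a; first by rewrite nth_nil; case: ifP.
      apply: (pos [:: 3; 5] _ ([:: 3; 5; 1; 4] ++ flatten (nseq k' period))) => // {}a.
      apply: (pos [:: 3; 5] _ ([:: 1; 4] ++ flatten (nseq k' period))) => // {}a.
      exact: (pos [:: 1; 4]).
    by apply.
  have r1 i : i < n -> 0 < count (eq i) (iota 0 n).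
    by move=> i_n; rewrite -has_count; apply/hasP; exists i; rewrite ?mem_iota ?eqE ?eqxx.
  have := r1 _ (_ : v./2 < n); have := r1 _ (_ : v./2.+1 %% n < n).
  rewrite /room ltn_mod; case: (odd v) => h1 h2;
  by have := h1 ltac:(lia); have := h2 ltac:(lia); lia.
- move=> v w vw wN cl.
  (* Labels in conflict are within reach, in one direction or the other. *)
  have : [|| w <= v + reach v | v + 2 * n <= w + reach w].
    have vn' : v./2 < n by lia. have wn' : w./2 < n by lia.
    have nxt j : j < n -> (j.+1 %% n = j.+1 /\ j.+1 < n) \/ (j.+1 %% n = 0 /\ j.+1 = n).
      move=> jn; case: (ltnP j.+1 n) => [j1|nj]; first by left; rewrite modn_small.
      by right; have jE : j.+1 = n by [lia]; rewrite jE modnn.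
    have nearE i j : i < n -> j < n -> near n i j ->
       [\/ i = j, i.+1 = j, j.+1 = i | i.+1 = n /\ j = 0 \/ j.+1 = n /\ i = 0].
      move=> i_n j_n; case: (nxt i i_n) => -[Ei ?]; case: (nxt j j_n) => -[Ej ?].
      - by case/or3P=> /eqP; rewrite ?Ei ?Ej; [constructor 1|constructor 2|constructor 3].
      - by case/or3P=> /eqP; rewrite ?Ei ?Ej; [constructor 1|constructor 2|constructor 4; lia].
      - by case/or3P=> /eqP; rewrite ?Ei ?Ej; [constructor 1|constructor 4; lia|constructor 3].
      - by case/or3P=> /eqP; rewrite ?Ei ?Ej; [constructor 1|constructor 4; lia|constructor 4; lia].
    have eqE' i j : i < n -> j < n -> eq i j -> near n i j.
      by move=> i_n j_n; rewrite eqE // /near => ->.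
    have ov := odd_double_half v; have ow := odd_double_half w.
    have vn2 := nxt _ vn'; have wn2 := nxt _ wn'.
    have vs : v./2.+1 %% n < n by rewrite ltn_mod; lia.
    have ws : w./2.+1 %% n < n by rewrite ltn_mod; lia.
    have E : near n v./2 w./2 \/
        odd w /\ near n v./2 (w./2.+1 %% n) \/ odd v /\ near n (v./2.+1 %% n) w./2.
      move: cl; rewrite /clash; case: (odd v); case: (odd w).
      - by case/or3P=> N; [left|right; left|right; right].
      - case/or4P=> [||/eqE'|/eqE'] N; rewrite nearC in N;
        by [left|right; right|left; apply: N|right; right; split; last apply: N].
      - by case/or4P=> [||/eqE'|/eqE'] N;
          [left|right; left|left; apply: N|right; left; split; last apply: N].
      - by case/or3P=> [|/eqE'|/adE] N; left; last apply: N; try apply: N.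
    rewrite /reach; case: E => [|[[o]|[o]]] /nearE; rewrite ?vn' ?wn' ?vs ?ws => /(_ isT isT).
    + by case; lia.
    + by rewrite o in ow *; case; lia.
    + by rewrite o in ov *; case; lia.
  rewrite /circ mem_cat; case/orP => vwr.
    apply/orP; right; apply/flatten_mapP; exists v; first by rewrite mem_iota; lia.
    by apply/mapP; exists w; rewrite // mem_iota; lia.
  apply/orP; left; rewrite /reach in vwr.
  have : [|| (w == 2 * n - 1) && (v < 4), (w == 2 * n - 2) && (v < 2)
           | (w == 2 * n - 3) && (v < 2)] by lia.
  by case/or3P=> /andP[/eqP ->]; move: (v) => [|[|[|[|//]]]] // _;
     rewrite !inE !xpair_eqE !eqxx ?orbT.
Qed.

(** * Short cycles *)

(** Here x i is the outer end of the spoke i, in any type with an adjacency. Each case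
comes with exponents D found by a search; the computations check that the
coefficient is nonzero and that D is below the list sizes. *)
Section ShortCycles.
Variables (T : eqType) (x : nat -> T) (adj : rel T).
Hypothesis adjC : symmetric adj.
Hypothesis adj0 : irreflexive adj.
Let eq i j := x i == x j.
Let ad i j := adj (x i) (x j).
(* The bounds used for equality and adjacency of outer ends: [same cl] compares
   the classes listed in cl, [eqi] has no coincidences. *)
Let none : rel nat := fun _ _ => false.
Let any : rel nat := fun _ _ => true.
Let same (cl : seq nat) : rel nat := fun i j => nth 0 cl i == nth 0 cl j.
Let eqi : rel nat := fun i j => i == j.

Let eqi_eq i j : eqi i j -> eq i j.
Proof. by move=> /eqP ->; rewrite /eq. Qed.

Lemma same_of_lt n cl : (forall i j, i < j -> j < n -> eq i j = same cl i j) ->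
  forall i j, i < n -> j < n -> eq i j = same cl i j.
Proof.
move=> H i j i_n j_n; case: (ltngtP i j) => [ij|ji|->]; first exact: H.
  by rewrite /eq eq_sym [LHS]H // /same eq_sym.
by rewrite /eq /same !eqxx.
Qed.

(** Even if all six edges conflict, they can be coloured one after the other: spokes
have at least four colours and rim edges six. The exponents are
the outdegrees of an acyclic orientation of the complete graph, which is the only
one with these outdegrees. *)
Lemma choosable3 : choosable (2 * 3) (clash 3 eq ad) (room 3 eq ad).
Proof.
apply: (@certified_choosable 3 _ _ any any eqi none [:: 0; 3; 1; 4; 2; 5]) => //.
- by move=> i j _ _; apply: eqi_eq.
- by move=> i j _ _ _; apply: orbT.
Qed.

(** Around a shortest 6-cycle, only opposite spokes can have adjacent outer ends. If
some do not, the conflicts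
are fewer, so it is safe to assume that all do, without counting
on the extra colours. *)
Lemma choosable6 :
  (forall i j, i < 6 -> j < 6 -> eq i j -> i == j) ->
  (forall i j, i < 6 -> j < 6 -> ad i j -> near 6 i j || (i + 3 == j %[mod 6])) ->
  choosable (2 * 6) (clash 6 eq ad) (room 6 eq ad).
Proof.
move=> eqE adE.
apply: (@certified_choosable 6 _ _ eqi (fun i j => i + 3 == j %[mod 6]) eqi none
  [:: 3; 5; 3; 5; 3; 5; 3; 5; 3; 5; 0; 5]) => //.
  by move=> i j _ _; apply: eqi_eq.
Qed.

(** Opposite spokes may share their outer end, which leaves four patterns. *)
Lemma choosable4 :
  (forall i, x i.+1 != x i) -> (forall i, x (i + 4) = x i) ->
  (forall i, ~~ ad i i.+2) ->
  choosable (2 * 4) (clash 4 eq ad) (room 4 eq ad).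
Proof.
move=> x1 x4 ad2.
have [cl [D [clE cD fD]]] : exists cl D, [/\ forall i j, i < 4 -> j < 4 -> eq i j = same cl i j,
    certifies (2 * 4) (clash 4 (same cl) none) D & fits (2 * 4) (room 4 (same cl) none) D].
  have m0 : (x 0 == x 1) = false by rewrite eq_sym (negPf (x1 0)).
  have m1 : (x 1 == x 2) = false by rewrite eq_sym (negPf (x1 1)).
  have m2 : (x 2 == x 3) = false by rewrite eq_sym (negPf (x1 2)).
  have m3 : (x 0 == x 3) = false by rewrite -(x4 0) (negPf (x1 3)).
  have go cl : (x 0 == x 2) = same cl 0 2 -> (x 1 == x 3) = same cl 1 3 ->
      [&& ~~ same cl 0 1, ~~ same cl 1 2, ~~ same cl 2 3 & ~~ same cl 0 3] ->
      forall i j, i < 4 -> j < 4 -> eq i j = same cl i j.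
    move=> E02 E13 /and4P[/negPf F01 /negPf F12 /negPf F23 /negPf F03].
    apply: same_of_lt => -[|[|[|[|i]]]] [|[|[|[|j]]]] // _ _;
    by rewrite /eq ?E02 ?E13 ?m0 ?m1 ?m2 ?F01 ?F12 ?F23 ?F03 ?m3.
  case e02: (x 0 == x 2); case e13: (x 1 == x 3).
  - exists [:: 0; 1; 0; 1]; exists [:: 1; 7; 2; 6; 3; 4; 0; 5].
    split; [|by vm_compute|by vm_compute].
    by apply: go.
  - exists [:: 0; 1; 0; 3]; exists [:: 6; 5; 3; 4; 1; 3; 3; 2].
    split; [|by vm_compute|by vm_compute].
    by apply: go.
  - exists [:: 0; 1; 2; 1]; exists [:: 3; 3; 2; 1; 3; 5; 6; 4].
    split; [|by vm_compute|by vm_compute].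
    by apply: go.
  - exists [:: 0; 1; 2; 3]; exists [:: 3; 3; 3; 2; 3; 4; 3; 5].
    split; [|by vm_compute|by vm_compute].
    by apply: go.
apply: (certified_choosable _ _ _ _ cD fD) => //.
- by move=> i j i4 j4; rewrite clE.
- by move=> i j i4 j4; rewrite clE.
- move=> [|[|[|[|i]]]] [|[|[|[|j]]]] // _ _ a;
  first [by case/negP: (ad2 0) | by case/negP: (ad2 1) |
         by case/negP: (ad2 0); rewrite /ad adjC | by case/negP: (ad2 1); rewrite /ad adjC].
Qed.

(* Entry i of b tells whether the outer ends of the spokes i and i + 2 are adjacent. *)
Let chord (b : seq bool) : rel nat := fun i j =>
  ((i + 2) %% 5 == j) && nth false b i || ((j + 2) %% 5 == i) && nth false b j.

(** The row with index m serves the patterns with m adjacent pairs of outer ends;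
each of these patterns is served by one of the exponents in the row. *)
Definition chord_degrees := [::
  [:: [:: 3; 4; 3; 4; 3; 5; 2; 5; 1; 5]];
  [:: [:: 3; 5; 3; 4; 3; 5; 3; 5; 0; 5]];
  [:: [:: 4; 5; 3; 5; 3; 5; 3; 4; 1; 4]; [:: 3; 4; 4; 5; 1; 5; 2; 5; 3; 5]];
  [:: [:: 3; 4; 3; 5; 4; 5; 1; 5; 3; 5]; [:: 4; 4; 4; 5; 0; 5; 3; 5; 3; 5]];
  [:: [:: 4; 5; 4; 5; 4; 4; 4; 3; 1; 5]];
  [:: [:: 5; 0; 5; 5; 3; 5; 4; 5; 4; 4]]].

Lemma choosable5 : (forall i j, i < 5 -> j < 5 -> eq i j -> i == j) ->
  choosable (2 * 5) (clash 5 eq ad) (room 5 eq ad).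
Proof.
move=> eqE; pose b := [:: ad 0 2; ad 1 3; ad 2 4; ad 3 0; ad 4 1].
have [D /andP[cD fD]] : exists D, certifies (2 * 5) (clash 5 eqi (chord b)) D &&
    fits (2 * 5) (room 5 eqi (chord b)) D.
  suff /hasP[D _ DP] : has (fun D => certifies (2 * 5) (clash 5 eqi (chord b)) D &&
    fits (2 * 5) (room 5 eqi (chord b)) D) (nth [::] chord_degrees (count id b)) by exists D.
  rewrite /b; case: (ad 0 2); case: (ad 1 3); case: (ad 2 4); case: (ad 3 0); case: (ad 4 1);
  by vm_compute.
apply: (certified_choosable _ _ _ _ cD fD) => //.
- by move=> i j _ _; apply: eqi_eq.
- move=> [|[|[|[|[|i]]]]] [|[|[|[|[|j]]]]] // _ _; rewrite /chord /= ?andbF ?orbF //;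
  by rewrite /ad adjC.
- move=> [|[|[|[|[|i]]]]] [|[|[|[|[|j]]]]] // _ _; rewrite /chord /= ?andbF ?orbF //;
  by rewrite /ad adjC.
Qed.

(* Adjacency of the classes 0, 1 and 2 of outer ends that cl assigns: the sums
   u + v are 1, 2 and 3 for the three pairs, so b lists them in this order. *)
Let linked (cl : seq nat) (b : seq bool) : rel nat := fun i j =>
  let u := nth 0 cl i in let v := nth 0 cl j in (u != v) && nth false b (u + v).-1.

(** One entry for each adjacency pattern of three classes, read as a binary number; the
first eight are for the spoke 3 ending with the spoke 1, the last eight for the spoke 4
ending with the spoke 1. *)
Definition merged_degrees := [::
  [:: 6; 7; 0; 7; 5; 5; 5; 4; 0; 2]; [:: 6; 7; 6; 6; 1; 5; 6; 3; 2; 0];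
  [:: 6; 7; 0; 7; 6; 5; 6; 3; 0; 2]; [:: 1; 3; 4; 7; 7; 6; 7; 0; 6; 2];
  [:: 8; 6; 8; 0; 4; 4; 7; 3; 0; 2]; [:: 7; 6; 9; 0; 1; 5; 8; 4; 0; 3];
  [:: 9; 2; 7; 3; 7; 4; 5; 1; 5; 0]; [:: 9; 2; 8; 3; 7; 4; 6; 1; 4; 0];
  [:: 1; 7; 6; 6; 6; 2; 2; 0; 6; 5]; [:: 1; 4; 4; 6; 6; 0; 5; 2; 7; 7];
  [:: 7; 7; 1; 6; 6; 0; 2; 2; 6; 5]; [:: 3; 3; 4; 7; 6; 0; 7; 1; 6; 6];
  [:: 2; 1; 8; 4; 8; 0; 3; 3; 7; 6]; [:: 1; 0; 9; 4; 7; 3; 4; 2; 8; 5];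
  [:: 9; 0; 2; 4; 8; 3; 3; 1; 7; 6]; [:: 9; 1; 8; 3; 7; 0; 3; 2; 6; 5]].

(** Consecutive spokes have different ends, so besides 0 and 2 only the spokes 1 and 3, or 1
and 4, can share their end. If neither pair does, then the colours gained
by the coincidence of 0 and 2 outweigh all possible conflicts between spokes. *)
Lemma choosable5_merged :
  (forall i, x i.+1 != x i) -> (forall i, x (i + 5) = x i) -> x 2 = x 0 ->
  choosable (2 * 5) (clash 5 eq ad) (room 5 eq ad).
Proof.
move=> x1 x5 x20.
have m0 : (x 0 == x 1) = false by rewrite eq_sym (negPf (x1 0)).
have m3 : (x 0 == x 3) = false by rewrite -x20 eq_sym (negPf (x1 2)).
have m4 : (x 3 == x 4) = false by rewrite eq_sym (negPf (x1 3)).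
have m5 : (x 0 == x 4) = false by rewrite -(x5 0) (negPf (x1 4)).
have m10 : (x 1 == x 0) = false by rewrite eq_sym m0.
have classes cl : (x 1 == x 3) = same cl 1 3 -> (x 1 == x 4) = same cl 1 4 ->
    [&& same cl 0 2, ~~ same cl 0 1, ~~ same cl 0 3, ~~ same cl 0 4 & ~~ same cl 3 4] ->
    forall i j, i < 5 -> j < 5 -> eq i j = same cl i j.
  move=> E13 E14 /and5P[/eqP C02 /negPf F01 /negPf F03 /negPf F04 /negPf F34].
  rewrite /same in F01 F03 F04 F34.
  apply: same_of_lt => -[|[|[|[|[|i]]]]] [|[|[|[|[|j]]]]] // _ _;
  rewrite /eq ?x20 ?E13 ?E14 ?m0 ?m10 ?m3 ?m4 ?m5 /same -?C02 ?eqxx ?F01 ?F03 ?F04 ?F34 //.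
  by rewrite eq_sym F01.
have links cl b : (forall i j, i < 5 -> j < 5 -> ad i j = linked cl b i j) ->
    (forall i j, i < 5 -> j < 5 -> eq i j = same cl i j) ->
    (exists D, certifies (2 * 5) (clash 5 (same cl) (linked cl b)) D &&
       fits (2 * 5) (room 5 (same cl) (linked cl b)) D) ->
    choosable (2 * 5) (clash 5 eq ad) (room 5 eq ad).
  move=> adE clE [D /andP[cD fD]].
  apply: (certified_choosable _ _ _ _ cD fD) => i j i5 j5.
  - by rewrite clE.
  - by rewrite clE.
  - by rewrite adE // => ->; rewrite orbT.
  - by rewrite adE.
case e13: (x 1 == x 3); [|case e14: (x 1 == x 4)].
- have x31 : x 3 = x 1 by rewrite (eqP e13).
  apply: (@links [:: 0; 1; 0; 1; 2] [:: ad 0 1; ad 0 4; ad 1 4]).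
  + move=> [|[|[|[|[|i]]]]] [|[|[|[|[|j]]]]] // _ _; rewrite /linked /= /ad ?x20 ?x31 ?adj0 //;
    by rewrite adjC.
  + by apply: classes => //; rewrite -x31 m4.
  + exists (nth [::] merged_degrees (4 * ad 0 1 + 2 * ad 0 4 + ad 1 4)).
    by case: (ad 0 1); case: (ad 0 4); case: (ad 1 4); vm_compute.
- have x41 : x 4 = x 1 by rewrite (eqP e14).
  apply: (@links [:: 0; 1; 0; 2; 1] [:: ad 0 1; ad 0 3; ad 1 3]).
  + move=> [|[|[|[|[|i]]]]] [|[|[|[|[|j]]]]] // _ _; rewrite /linked /= /ad ?x20 ?x41 ?adj0 //;
    by rewrite adjC.
  + by apply: classes.
  + exists (nth [::] merged_degrees (8 + (4 * ad 0 1 + 2 * ad 0 3 + ad 1 3))).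
    by case: (ad 0 1); case: (ad 0 3); case: (ad 1 3); vm_compute.
- have clE := classes [:: 0; 1; 0; 2; 3] e13 e14 isT.
  apply: (@certified_choosable 5 _ _ (same [:: 0; 1; 0; 2; 3]) any (same [:: 0; 1; 0; 2; 3]) none
    [:: 6; 6; 1; 6; 5; 4; 3; 5; 3; 3]).
  + by move=> i j i5 j5; rewrite clE.
  + by move=> i j i5 j5; rewrite clE.
  + by move=> i j _ _ _; apply: orbT.
  + by [].
  + by vm_compute.
  + by vm_compute.
Qed.

End ShortCycles.

(** * Colouring the edges off the rim *)

(** Lets the number of values of f on S be bounded by the size of S, for the
comprehensions [[fset f x | x in S]]. *)
Lemma size_enum_finmem (T : finType) (p : finmempred T) (S : {set T}) :
  pred_of_finmempred p =i S -> size (enum_finmem p) = #|S|.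
Proof.
move=> pS; rewrite cardE; apply/perm_size/uniq_perm; rewrite ?enum_finmem_uniq ?enum_uniq //.
by move=> x; rewrite enum_finmemE mem_enum pS.
Qed.

Lemma cover_card (T : finType) (I : finType) (S : {set T}) (Y : {set I}) (F : I -> {set T}) :
  (forall f, f \in S -> exists2 y, y \in Y & f \in F y) -> #|S| <= \sum_(y in Y) #|F y|.
Proof.
move=> cov; have /subset_leq_card le : S \subset \bigcup_(y in Y) F y.
  by apply/subsetP => f /cov[y yY fF]; apply/bigcupP; exists y.
apply: leq_trans le _; elim/big_rec2: _ => [|a m' U _ le]; first by rewrite cards0.
by apply: leq_trans (leq_card_setU _ _) _; rewrite leq_add2l.
Qed.

Lemma periodic_mod (T : Type) (f : nat -> T) n i : (forall i, f (i + n) = f i) -> f i = f (i %% n).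
Proof.
move=> fn; rewrite [in LHS](divn_eq i n); elim: (i %/ n) => [|k IH]; first by rewrite mul0n.
by rewrite mulSn -addnA addnC fn IH.
Qed.

Section Graph.
Variable G : sgraph.
Hypothesis cubG : cubic G.

Definition nb (a : G) : {set G} := [set w | adj a w].
Definition inc (a : G) : {set edge G} := [set f : edge G | a \in val f].
Definition touch (a b : G) := (a == b) || adj a b.
Definition conflict (e f : edge G) :=
  (e != f) && [exists a in val e, exists b in val f, touch a b].

Lemma mem_nb a w : (w \in nb a) = adj a w. Proof. by rewrite inE. Qed.

Lemma card_nb a : #|nb a| = 3. Proof. exact: cubG. Qed.

Lemma edgeP (e : edge G) : exists u v, adj u v /\ val e = [set u; v].
Proof.
have := valP e; rewrite inE => /existsP[u /existsP[v /andP[uv /eqP E]]].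
by exists u, v.
Qed.

Lemma edge_memP (e : edge G) u : u \in val e -> exists2 v, adj u v & val e = [set u; v].
Proof.
have [a [b [ab ->]]] := edgeP e; rewrite !inE => /orP[] /eqP ->; first by exists b.
by exists a; [rewrite adj_sym | rewrite setUC].
Qed.

Lemma ends_edge u v : adj u v -> [set u; v] \in edge_set G.
Proof.
by move=> uv; rewrite inE; apply/existsP; exists u; apply/existsP; exists v; rewrite uv eqxx.
Qed.

Lemma edge_with_ends u v : adj u v -> exists e : edge G, val e = [set u; v].
Proof. by move=> uv; exists (Sub [set u; v] (ends_edge uv)); rewrite SubK. Qed.

Lemma set2_inj (a b c : G) : [set a; b] = [set a; c] -> b = c.
Proof.
move=> E; have : b \in [set a; c] by rewrite -E !inE eqxx orbT.
have : c \in [set a; b] by rewrite E !inE eqxx orbT.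
by rewrite !inE => /orP[/eqP ->|/eqP ->] // /orP[/eqP ->|/eqP ->].
Qed.

Lemma imset_inc a : val @: inc a = [set [set a; b] | b in nb a].
Proof.
apply/setP => s; apply/imsetP/imsetP => [[f]|[b]].
  by rewrite inE => /edge_memP[b ab fE] ->; exists b; rewrite ?mem_nb.
rewrite mem_nb => /edge_with_ends[f fE] ->; exists f; rewrite ?fE //.
by rewrite inE fE !inE eqxx.
Qed.

Lemma card_inc a : #|inc a| = 3.
Proof.
rewrite -(card_imset _ val_inj) imset_inc card_in_imset ?card_nb //.
by move=> b c _ _; apply: set2_inj.
Qed.

Lemma conflictC e f : conflict e f = conflict f e.
Proof.
rewrite /conflict eq_sym; congr (_ && _).
apply/exists_inP/exists_inP => -[a ae /exists_inP[b bf ab]];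
  by exists b => //; apply/exists_inP; exists a; rewrite // /touch eq_sym adj_sym.
Qed.

Definition around (e : edge G) : {set G} := [set a | [exists u in val e, adj u a]] :\: val e.

Lemma around2 e u v : val e = [set u; v] -> around e = (nb u :|: nb v) :\: [set u; v].
Proof.
move=> E; apply/setP => a; rewrite /around E in_setD [RHS]in_setD; congr (_ && _).
rewrite !inE; apply/exists_inP/orP => [[w]|[] wa].
- by rewrite !inE => /orP[] /eqP ->; [left | right].
- by exists u; rewrite ?inE ?eqxx.
- by exists v; rewrite ?inE ?eqxx ?orbT.
Qed.

(** Each end of an edge has two neighbours other than the opposite end. *)
Lemma card_around e : #|around e| <= 4.
Proof.
have [u [v [uv E]]] := edgeP e; rewrite (around2 E).
have -> : (nb u :|: nb v) :\: [set u; v] = (nb u :\ v) :|: (nb v :\ u).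
  apply/setP => w; rewrite !inE; case: (eqVneq w u) => [->|_] /=.
    by rewrite adj_irrefl !andbF.
  by case: (eqVneq w v) => [->|_] /=; rewrite ?adj_irrefl.
apply: leq_trans (leq_card_setU _ _) _.
have := cardsD1 v (nb u); have := cardsD1 u (nb v).
by rewrite !mem_nb uv adj_sym uv !card_nb; lia.
Qed.

Lemma conflict_around e f : conflict e f -> exists2 a, a \in around e & a \in val f.
Proof.
case/andP=> ef /exists_inP[a ae /exists_inP[b bf ab]].
have [v av eE] := edge_memP ae; have [w bw fE] := edge_memP bf.
rewrite (around2 eE).
have sep : forall z, adj b z -> val f = [set b; z] -> b \in val e -> 
   exists2 a0, a0 \in (nb a :|: nb v) :\: [set a; v] & a0 \in val f.
  move=> z bz fE' be; exists z; last by rewrite fE' !inE eqxx orbT.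
  rewrite inE; apply/andP; split.
    rewrite -eE; apply/negP => ze; case/eqP: ef; apply: val_inj; rewrite /= fE'.
    have [y _ eE'] := edge_memP be; move: ze; rewrite eE' !inE => /orP[] /eqP zE.
      by rewrite zE adj_irrefl in bz.
    by rewrite zE.
  by move: be; rewrite eE !inE => /orP[] /eqP E; rewrite -E bz ?orbT.
case: (boolP (b \in val e)) => be; first exact: (sep w bw fE be).
exists b; rewrite // inE -eE be /= !inE.
case/orP: ab => [/eqP E|->//]; by rewrite -E ae in be.
Qed.

Variables (C : choiceType) (L : edge G -> {fset C}).
Hypothesis L10 : forall e, 10 <= #|` L e|%fset.

(** Partial colourings are total functions whose conflicts are controlled on A, so that
one more edge is coloured by changing one value. *)
Definition strong_on (A : {set edge G}) (phi : edge G -> C) :=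
  (forall e, phi e \in L e) /\
  (forall e f, e \in A -> f \in A -> conflict e f -> phi e != phi f).

Lemma card_free_colors (A : {fset C}) (S : {set edge G}) (phi : edge G -> C) :
  #|` A|%fset <= #|` (A `\` [fset phi f | f in S])%fset|%fset + #|S|.
Proof.
rewrite -(cardfsID [fset phi f | f in S]%fset A) addnC leq_add2l.
apply: leq_trans (fsubset_leq_card (fsubsetIr _ _)) _.
by apply: leq_trans (leq_imfset_card _ _ _) _; rewrite (size_enum_finmem (S := S)).
Qed.

Lemma pick_color (e : edge G) (S : {set edge G}) (phi : edge G -> C) : #|S| < 10 ->
  exists2 c, c \in L e & forall f, f \in S -> phi f != c.
Proof.
move=> S10; have : 0 < #|` (L e `\` [fset phi f | f in S])%fset|%fset.
  rewrite -(ltn_add2r #|S|) add0n; apply: leq_trans S10 _.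
  exact: leq_trans (L10 e) (card_free_colors _ _ _).
rewrite cardfs_gt0 => /fset0Pn[c]; rewrite in_fsetD => /andP[cS cL].
exists c => // f fS; apply: contraNneq cS => <-.
by apply/imfsetP; exists f.
Qed.

Definition recolor (phi : edge G -> C) e c := fun f => if f == e then c else phi f.

Lemma card_inc_cover (S : {set edge G}) (W : {set G}) m :
  (forall f, f \in S -> exists2 a, a \in W & a \in val f) -> #|W| <= m -> #|S| <= 3 * m.
Proof.
move=> SW Wm; apply: (@leq_trans (\sum_(a in W) #|inc a|)).
  by apply: cover_card => f /SW[a aW af]; exists a; rewrite ?inE.
by under eq_bigr => a _ do rewrite card_inc; rewrite sum_nat_const mulnC leq_mul2l.
Qed.

(** An edge all of whose coloured conflicts pass through three vertices sees at most
nine colours. *)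
Lemma greedy_step (A : {set edge G}) (e : edge G) (W : {set G}) phi :
  strong_on A phi -> #|W| <= 3 ->
  (forall f, f \in A -> conflict e f -> exists2 a, a \in W & a \in val f) ->
  exists phi', strong_on (e |: A) phi'.
Proof.
case=> pL pA W3 cov.
have S9 : #|[set f in A | conflict e f]| < 10.
  rewrite ltnS; apply: (@leq_trans (3 * 3)) => //; apply: card_inc_cover W3.
  by move=> f; rewrite inE => /andP[fA ef]; apply: cov.
have [c cL cS] := pick_color e phi S9.
exists (recolor phi e c); split=> [f|f g]; rewrite /recolor.
  by case: eqP => [->|].
rewrite !inE; case: (eqVneq f e) => [->|fe] /=; case: (eqVneq g e) => [->|ge] /=.
- by rewrite /conflict eqxx.
- by move=> _ gA eg; rewrite eq_sym cS // inE gA.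
- by move=> fA _; rewrite conflictC => ef; rewrite cS // inE fA.
- exact: pA.
Qed.

Lemma strong_on_empty : exists phi, strong_on set0 phi.
Proof.
have ne e : exists c, c \in L e.
  by apply/fset0Pn; rewrite -cardfs_gt0; apply: leq_trans (L10 e).
have [phi phiL] := fin_all_exists ne.
by exists phi; split=> // e f; rewrite inE.
Qed.

Variables (K R : {set G}) (d : G -> nat).
Hypothesis descent : forall a, a \in K -> a \notin R -> exists2 w, adj a w & d w < d a.

Definition outer_edges : {set edge G} :=
  [set e : edge G | (val e \subset K) && [disjoint val e & R]].

(** The edge to be coloured last is one that reaches closest to R: its end u has minimal
distance among the covered vertices, so the neighbour w of u which is closer to R
is on no edge of A, and only three vertices around e are left to pass
on a colour. *)
Lemma greedy_outside (A : {set edge G}) : A \subset outer_edges -> exists phi, strong_on A phi.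
Proof.
have [n] := ubnP #|A|; elim: n A => // n IH A An AU.
have [->|[e0 e0A]] := set_0Vmem A; first exact: strong_on_empty.
have [u0 [v0 [_ e0E]]] := edgeP e0.
pose covered (a : G) := [exists e in A, a \in val e].
have cov0 : covered u0 by apply/exists_inP; exists e0; rewrite // e0E !inE eqxx.
case: (arg_minnP d cov0) => u /exists_inP[e eA ue] umin.
have [v uv eE] := edge_memP ue.
have := subsetP AU e eA; rewrite inE => /andP[/subsetP eK /disjointFr eR].
have [w uw dw] := descent (eK _ ue) (negbT (eR _ ue)).
have ncov : ~~ covered w by apply/negP => /umin; rewrite leqNgt dw.
have ncovA f : f \in A -> w \notin val f.
  by move=> fA; apply: contra ncov => wf; apply/exists_inP; exists f.
have wM : w \in around e.
  by rewrite (around2 eE) in_setD -eE ncovA //= !inE uw.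
have [||phi ph] := IH (A :\ e).
- by move: An; rewrite (cardsD1 e) eA add1n ltnS.
- by apply: subset_trans AU; apply: subD1set.
have [||phi' ph'] := @greedy_step (A :\ e) e (around e :\ w) phi ph.
- by have := card_around e; rewrite (cardsD1 w) wM add1n ltnS.
- move=> f; rewrite !inE => /andP[_ fA] /conflict_around[a aM af].
  exists a => //; rewrite !inE in aM *; rewrite aM andbT.
  by apply: contraNneq (ncovA f fA) => <-.
by exists phi'; rewrite setD1K in ph'.
Qed.
End Graph.

(** * The edges at the rim *)
Section Spokes.
Variable G : sgraph.
Hypothesis cubG : cubic G.

(** An induced cycle c with the third neighbours x of its vertices. Indices are all
naturals, read modulo n, so that successors need no case distinction; [sp_out]
says that there are no chords. *)
Record spoked (n : nat) (c x : nat -> G) : Prop := Spoked {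
  sp_size : 2 < n;
  sp_cycle : forall i, c (i + n) = c i;
  sp_spokes : forall i, x (i + n) = x i;
  sp_inj : forall i j, i < n -> j < n -> c i = c j -> i = j;
  sp_nb : forall i, nb (c i.+1) = [set c i; c i.+2; x i.+1];
  sp_out : forall i j, x i != c j }.

Variables (n : nat) (c x : nat -> G).
Hypothesis sp : spoked n c x.
Let n3 := sp_size sp.

Lemma cycle_mod i : c i = c (i %% n).
Proof. exact: periodic_mod (sp_cycle sp). Qed.

Lemma spoke_mod i : x i = x (i %% n).
Proof. exact: periodic_mod (sp_spokes sp). Qed.

Lemma cycle_eq i j : c i = c j -> i = j %[mod n].
Proof. by rewrite cycle_mod [c j]cycle_mod; apply: (sp_inj sp); rewrite ltn_mod; lia. Qed.

Lemma nb_cycle i w : adj (c i) w = [|| w == c (i + n - 1), w == c i.+1 | w == x i].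
Proof.
have E : i + n = (i + n - 1).+1 by lia.
rewrite -mem_nb -(sp_cycle sp i) [in LHS]E (sp_nb sp) !inE -E (sp_spokes sp) -orbA.
by congr [|| _, _ == _ | _]; rewrite -addSn (sp_cycle sp).
Qed.

Lemma adj_next i : adj (c i) (c i.+1).
Proof. by rewrite nb_cycle eqxx orbT. Qed.

Lemma adj_spoke i : adj (c i) (x i).
Proof. by rewrite nb_cycle eqxx !orbT. Qed.

Lemma touch_cycle i j : i < n -> j < n -> touch (c i) (c j) -> near n i j.
Proof.
move=> i_n j_n; rewrite /touch /near nb_cycle.
case/orP=> [/eqP /cycle_eq E|/or3P[/eqP /cycle_eq E|/eqP /cycle_eq E|]].
- by rewrite (modn_small i_n) (modn_small j_n) in E; rewrite E eqxx.
- apply/or3P/Or33; have := congr1 (fun k => k.+1 %% n) E; rewrite /= -addn1 modnDml addn1 => ->.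
  rewrite -addn1 modnDml (_ : i + n - 1 + 1 = i + n); last by lia.
  by rewrite modnDr modn_small.
- by rewrite (modn_small j_n) in E; rewrite E eqxx orbT.
- by rewrite eq_sym (negPf (sp_out sp _ _)).
Qed.

Lemma touch_spoke i j : touch (c i) (x j) -> x i == x j.
Proof.
by rewrite /touch nb_cycle eq_sym !(negPf (sp_out sp _ _)) /= eq_sym.
Qed.

Lemma touchC (a b : G) : touch a b = touch b a.
Proof. by rewrite /touch eq_sym adj_sym. Qed.

Lemma near_succ i j : near n (i.+1 %% n) (j.+1 %% n) -> i < n -> j < n -> near n i j.
Proof.
rewrite /near => H i_n j_n; move: H.
have E k : (k.+1 %% n).+1 %% n = k.+2 %% n by rewrite -addn1 modnDml addn1.
have S a b : (a.+1 %% n == b.+1 %% n) = (a %% n == b %% n).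
  by rewrite -(addn1 a) -(addn1 b) eqn_modDr.
by rewrite !E !S (modn_small i_n) (modn_small j_n).
Qed.

(** The edges at the rim with the labels used by [clash]. *)
Definition ends v := if odd v then [set c v./2; c v./2.+1] else [set c v./2; x v./2].

Lemma ends_in v : ends v \in edge_set G.
Proof.
by rewrite /ends; case: ifP => _; apply: ends_edge; [apply: adj_next | apply: adj_spoke].
Qed.

Definition rim_edge v : edge G := Sub (ends v) (ends_in v).

Let eq i j := x i == x j.
Let ad i j := adj (x i) (x j).

Lemma conflict_clash v w : v < 2 * n -> w < 2 * n ->
  conflict (rim_edge v) (rim_edge w) -> clash n eq ad v w.
Proof.
move=> vn wn /andP[_ /exists_inP[a av /exists_inP[b bw]]].
have vn' : v./2 < n by lia. have wn' : w./2 < n by lia.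
have md k : k %% n < n by rewrite ltn_mod; lia.
move: av bw; rewrite !SubK /ends /clash.
rewrite (cycle_mod v./2.+1) (cycle_mod w./2.+1).
case: (odd v); case: (odd w); rewrite !inE => /orP[] /eqP -> /orP[] /eqP -> t.
- by rewrite touch_cycle.
- by rewrite (touch_cycle _ _ t) ?orbT.
- by rewrite (touch_cycle _ _ t) ?orbT.
- by rewrite near_succ ?(touch_cycle _ _ t).
- by rewrite nearC (touch_cycle _ _ t).
- by rewrite /eq (eq_sym (x _)) (touch_spoke t) ?orbT.
- by rewrite (nearC n w./2 (_ %% n)) (touch_cycle _ _ t) ?orbT.
- by rewrite /eq (eq_sym (x w./2) (x (_ %% n))) (touch_spoke t) ?orbT.
- by rewrite (touch_cycle _ _ t).
- by rewrite (touch_cycle _ _ t) ?orbT.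
- by rewrite touchC in t; rewrite /eq (eq_sym (x v./2)) (touch_spoke t) ?orbT.
- by rewrite touchC in t; rewrite /eq (eq_sym (x v./2) (x (_ %% n))) (touch_spoke t) ?orbT.
- by rewrite (touch_cycle _ _ t).
- by rewrite /eq (touch_spoke t) ?orbT.
- by rewrite touchC in t; rewrite /eq (eq_sym (x v./2)) (touch_spoke t) ?orbT.
- by case/orP: t => t; rewrite /eq /ad t ?orbT.
Qed.

Definition rim : {set G} := [set c k | k : 'I_n].

Lemma mem_rim a : reflect (exists2 k, k < n & a = c k) (a \in rim).
Proof.
apply: (iffP imsetP) => [[k _ ->]|[k kn ->]]; first by exists k.
by exists (Ordinal kn).
Qed.

Lemma cycle_in_rim k : c k \in rim.
Proof. by apply/mem_rim; exists (k %% n); rewrite -?cycle_mod ?ltn_mod //; lia. Qed.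

Lemma spoke_out k : x k \notin rim.
Proof. by apply/mem_rim => -[j _ E]; have := sp_out sp k j; rewrite E eqxx. Qed.

Lemma rim_edge_surj (e : edge G) a : a \in val e -> a \in rim ->
  exists2 v, v < 2 * n & e = rim_edge v.
Proof.
move=> ae /mem_rim[i i_n E]; have [b ab eE] := edge_memP ae.
rewrite E in ab eE; move: ab; rewrite nb_cycle => /or3P[] /eqP bE.
- have iE : c i = c (i + n - 1).+1 by rewrite (_ : _.+1 = i + n) ?(sp_cycle sp) //; lia.
  exists ((i + n - 1) %% n).*2.+1; first by have := ltn_pmod (i + n - 1) (_ : 0 < n); lia.
  have mE : c ((i + n - 1) %% n).+1 = c i.
    by rewrite cycle_mod -addn1 modnDml addn1 -cycle_mod -iE.
  by apply: val_inj; rewrite SubK /ends /= odd_double uphalf_double mE -cycle_mod eE bE setUC.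
- exists i.*2.+1; first lia.
  by apply: val_inj; rewrite SubK /ends /= odd_double uphalf_double eE bE.
- exists i.*2; first lia.
  by apply: val_inj; rewrite SubK /ends odd_double doubleK eE bE.
Qed.

Let r i := count (eq i) (iota 0 n).

Lemma count_rim (P : pred nat) (S : {set G}) :
  (forall k, k < n -> P k -> c k \in S) -> count P (iota 0 n) <= #|S :&: rim|.
Proof.
move=> PS; rewrite -size_filter -(size_map c) cardE; apply: uniq_leq_size.
  rewrite map_inj_in_uniq ?filter_uniq ?iota_uniq // => i j.
  by rewrite !mem_filter !mem_iota => /andP[_ i_n] /andP[_ j_n]; apply: (sp_inj sp); lia.
move=> a /mapP[k]; rewrite mem_filter mem_iota => /andP[Pk kn] ->.
by rewrite mem_enum inE PS ?cycle_in_rim //; lia.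
Qed.

(** The edges at a that may have been coloured before the rim: each neighbour
of a on the rim takes away one of the three. *)
Definition off_rim (a : G) : {set edge G} := [set f in inc a | [disjoint val f & rim]].

Lemma card_off_rim a : #|off_rim a| + #|nb a :&: rim| <= 3.
Proof.
rewrite -(card_nb cubG a) -(cardsID rim (nb a)) addnC leq_add2l.
rewrite -(card_imset _ val_inj).
apply: leq_trans (leq_imset_card (fun b => [set a; b]) (nb a :\: rim)).
apply/subset_leq_card/subsetP => s /imsetP[f]; rewrite !inE => /andP[af dis] ->.
have [b ab fE] := edge_memP af; apply/imsetP; exists b => //.
by rewrite !inE ab andbT (disjointFr dis) // fE !inE eqxx orbT.
Qed.

Lemma card_off_spoke i : #|off_rim (x i)| + r i <= 3.
Proof.
apply: leq_trans (card_off_rim (x i)); rewrite leq_add2l; apply: count_rim => k _ /eqP E.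
by rewrite mem_nb adj_sym E adj_spoke.
Qed.

(** A spoke with outer end y adjacent to x_i contributes its inner end to the neighbours of y on
the rim. *)
Lemma count_linked i :
  count (ad i) (iota 0 n) <= \sum_(y in nb (x i) :\: rim) #|nb y :&: rim|.
Proof.
have cnt (P : pred nat) : count P (iota 0 n) = \sum_(k <- iota 0 n) P k.
  by rewrite -sum1_count big_mkcond; apply: eq_bigr => k _; case: (P k).
apply: (@leq_trans (\sum_(y in nb (x i) :\: rim) count (fun k => x k == y) (iota 0 n))).
  under [leqRHS]eq_bigr => y _ do rewrite cnt.
  rewrite cnt exchange_big; apply: leq_sum => k _ /=.
  case: (boolP (ad i k)) => // ik; rewrite (bigD1 (x k)) /= ?eqxx //.
  by rewrite in_setD spoke_out mem_nb.
apply: leq_sum => y _; apply: count_rim => k _ /eqP <-.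
by rewrite mem_nb adj_sym adj_spoke.
Qed.

Variable K : {set G}.

Definition seen v : {set edge G} := [set f in outer_edges K rim | conflict (rim_edge v) f].

(** Let r_i be the number of spokes that end in x_i, and a_i the number of spokes whose
ends are adjacent to x_i. A rim edge conflicts with coloured edges only
through x_i and x_(i+1), which have 3 - r_i and 3 - r_(i+1) edges off the rim at
most. A spoke does so through the at most 3 - r_i neighbours of x_i off the rim, and
among the three edges at each of these, those to the rim, at least a_i in all, do not
count. Subtracting from 10 gives [room]. *)
Lemma seen_room v : v < 2 * n -> #|seen v| + room n eq ad v <= 10.
Proof.
move=> vn.
have off f a : f \in seen v -> a \in val f -> a \notin rim /\ f \in off_rim a.
  rewrite !inE => /andP[/andP[_ dis] _] af; split; first by rewrite (disjointFr dis).
  by rewrite af.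
rewrite /room; case: ifPn => ov.
  have eE : val (rim_edge v) = [set c v./2; c v./2.+1] by rewrite SubK /ends ov.
  have le : #|seen v| <= #|off_rim (x v./2)| + #|off_rim (x (v./2.+1 %% n))|.
    apply: leq_trans (leq_card_setU _ _); apply/subset_leq_card/subsetP => f fS.
    have := fS; rewrite inE => /andP[_ /conflict_around[a aM af]].
    rewrite (around2 eE) !inE !nb_cycle in aM.
    have [ar fo] := off f a fS af; rewrite in_setU.
    have ne k : (a == c k) = false by apply: contraNF ar => /eqP ->; apply: cycle_in_rim.
    by move: aM; rewrite !ne /= -spoke_mod => /orP[] /eqP <-; rewrite fo ?orbT.
  have h1 := card_off_spoke v./2; have h2 := card_off_spoke (v./2.+1 %% n).
  rewrite -/(r v./2) -/(r (v./2.+1 %% n)).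
  clear -le h1 h2; lia.
have eE : val (rim_edge v) = [set c v./2; x v./2] by rewrite SubK /ends (negPf ov).
pose Y := nb (x v./2) :\: rim.
have le : #|seen v| <= \sum_(y in Y) #|off_rim y|.
  apply: cover_card => f fS; have := fS; rewrite inE => /andP[_ /conflict_around[a aM af]].
  rewrite (around2 eE) !inE nb_cycle in aM.
  have [ar fo] := off f a fS af; exists a => //.
  have ne k : (a == c k) = false by apply: contraNF ar => /eqP ->; apply: cycle_in_rim.
  rewrite in_setD ar mem_nb; move: aM; rewrite !ne /=.
  by case: (a == _).
have sumY : \sum_(y in Y) #|off_rim y| + \sum_(y in Y) #|nb y :&: rim| <= 3 * #|Y|.
  rewrite -big_split /= mulnC -sum_nat_const; apply: leq_sum => y _; exact: card_off_rim.
have h1 := count_linked v./2; rewrite -/Y in h1.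
have h2 := cardsID rim (nb (x v./2)); rewrite card_nb // -/Y in h2.
have h3 : r v./2 <= #|nb (x v./2) :&: rim|.
  by apply: count_rim => k _ /eqP E; rewrite mem_nb adj_sym E adj_spoke.
rewrite -/(r v./2); clear -le sumY h1 h2 h3; lia.
Qed.

Variables (C : choiceType) (L : edge G -> {fset C}) (d : G -> nat).
Hypothesis L10 : forall e, 10 <= #|` L e|%fset.
Hypothesis descent : forall a, a \in K -> a \notin rim -> exists2 w, adj a w & d w < d a.

(** The colours of edges off the rim are deleted from the lists at the rim; what is left is
at least [room], so that the two colourings fit together. *)
Lemma color_component : choosable (2 * n) (clash n eq ad) (room n eq ad) ->
  exists phi, strong_on L [set e : edge G | val e \subset K] phi.
Proof.
move=> chs; have [phi [pL pG]] := greedy_outside cubG L10 descent (subxx _).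
pose L' (i : 'I_(2 * n)) := (L (rim_edge i) `\` [fset phi f | f in seen i])%fset.
have [|psi psiL psiG] := chs C L'.
  move=> i; have := seen_room (ltn_ord i); have := L10 (rim_edge i).
  have := card_free_colors (L (rim_edge i)) (seen i) phi; rewrite -/(L' i).
  move=> h1 h2 h3; rewrite -(leq_add2l #|seen i|); apply: leq_trans h3 _.
  by apply: leq_trans h2 _; rewrite addnC.
pose lab (f : edge G) := [pick i : 'I_(2 * n) | rim_edge i == f].
pose phi' f := if lab f is Some i then psi i else phi f.
exists phi'; split=> [e|e f].
  rewrite /phi' /lab; case: pickP => [i /eqP <-|_] //.
  by have := psiL i; rewrite in_fsetD => /andP[].
rewrite !inE /phi' /lab => eK fK.
have outs (g : edge G) : val g \subset K ->
    (forall i : 'I_(2 * n), rim_edge i == g = false) -> g \in outer_edges K rim.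
  move=> gK gn; rewrite inE gK /=; apply/pred0P => a /=; apply/negP => /andP[ag ar].
  by have [v vn E] := rim_edge_surj ag ar; have := gn (Ordinal vn); rewrite E eqxx.
have mixed (i : 'I_(2 * n)) g : g \in outer_edges K rim ->
    conflict (rim_edge i) g -> psi i != phi g.
  move=> gO cg; have := psiL i; rewrite in_fsetD => /andP[ns _].
  by apply: contraNneq ns => ->; apply/imfsetP; exists g; rewrite //= inE gO.
case: pickP => [i /eqP ie|ne]; case: pickP => [j /eqP jf|nf] cf.
- have nij : i != j by apply: contraTneq cf => ij; rewrite -ie -jf ij /conflict eqxx.
  rewrite -ie -jf in cf; have vn := ltn_ord i; have wn := ltn_ord j.
  case: (ltngtP i j) => [ij|ji|/val_inj ij]; last by rewrite ij eqxx in nij.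
    by apply: psiG => //; apply: conflict_clash.
  by rewrite eq_sym; apply: psiG => //; rewrite conflictC in cf; apply: conflict_clash.
- by apply: mixed; [apply: outs | rewrite ie].
- by rewrite eq_sym; apply: mixed; [apply: outs | rewrite jf conflictC].
- by apply: pG cf; apply: outs.
Qed.
End Spokes.

(** * Shortest cycles *)
Section Cycles.
Variable G : sgraph.
Hypothesis cubG : cubic G.

(** A cycle as an n-periodic sequence, the form in which [spoked] wants it. *)
Definition closed_walk n (c : nat -> G) :=
  [/\ 2 < n, (forall i, c (i + n) = c i), (forall i j, i < n -> j < n -> c i = c j -> i = j)
    & forall i, adj (c i) (c i.+1)].

Lemma walk_eq n c i j : closed_walk n c -> c i = c j -> i = j %[mod n].
Proof.
case=> n3 cn ci _; rewrite (periodic_mod i cn) (periodic_mod j cn).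
by apply: ci; rewrite ltn_mod; lia.
Qed.

(** Each vertex of the cycle has one neighbour besides its two neighbours on the cycle, and
without chords it is off the cycle. *)
Lemma spokes_exist n c : closed_walk n c ->
  (forall i j, adj (c i) (c j) -> c j = c i.+1 \/ c i = c j.+1) -> exists x, spoked n c x.
Proof.
move=> cw chord; have [n3 cn ci ca] := cw.
have prE i : c (i + n - 1).+1 = c i by rewrite (_ : _.+1 = i + n) ?cn //; lia.
pose rest i := nb (c i) :\ c (i + n - 1) :\ c i.+1.
have rest1 i : exists w, rest i = [set w].
  apply/cards1P; have aP : adj (c i) (c (i + n - 1)) by rewrite adj_sym -[X in adj _ X]prE.
  have h1 := cardsD1 (c (i + n - 1)) (nb (c i)); rewrite card_nb // mem_nb aP in h1.
  have h2 := cardsD1 (c i.+1) (nb (c i) :\ c (i + n - 1)).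
  rewrite -/(rest i) !inE ca andbT in h2.
  case: (eqVneq (c i.+1) (c (i + n - 1))) h2 => [/(walk_eq cw) E _|_ h2].
    have : (i + n - 1).+1 = i.+2 %[mod n] by rewrite -addn1 -modnDml -E modnDml addn1.
    rewrite (_ : _.+1 = i + n); last by lia.
    rewrite modnDr => /eqP; rewrite -{1}[i]addn0 -addn2 eqn_modDl mod0n modn_small //.
  by rewrite h2 in h1; apply/eqP; case: h1.
pose x i := odflt (c 0) [pick w in rest i].
have xE i : rest i = [set x i].
  have [w wE] := rest1 i; rewrite /x; case: pickP => [v|/(_ w)]; rewrite wE !inE ?eqxx //.
  by move=> /eqP ->.
have nbE i : nb (c i) = [set c (i + n - 1); c i.+1; x i].
  apply/setP => w; have /setP /(_ w) := xE i; rewrite !inE.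
  have aP : adj (c i) (c (i + n - 1)) by rewrite adj_sym -[X in adj _ X]prE.
  case: (eqVneq w (c (i + n - 1))) => [->|_] /=; first by rewrite aP.
  by case: (eqVneq w (c i.+1)) => [->|_] /=; first by rewrite ca.
have x_adj i : adj (c i) (x i) by rewrite -mem_nb nbE !inE eqxx !orbT.
have x_rest i : x i \in rest i by rewrite xE inE.
exists x; split=> //.
- move=> i; rewrite /x; suff -> : rest (i + n) = rest i by [].
  by rewrite /rest cn -addSn cn (_ : i + n + n - 1 = i + n - 1 + n) ?cn //; lia.
- by move=> i; rewrite nbE (_ : i.+1 + n - 1 = i + n) ?cn //; lia.
- move=> i j; apply/eqP => xc; have := x_rest i; rewrite !inE xc => /and3P[n1 n2 aij].
  case: (chord i j aij) => [E|E]; first by rewrite E eqxx in n1.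
  case/eqP: n2; rewrite (periodic_mod j cn) (periodic_mod (i + n - 1) cn); congr c.
  have := walk_eq cw (etrans (prE i) E); rewrite -addn1 -[in RHS]addn1 => /eqP.
  by rewrite eqn_modDr eq_sym => /eqP.
Qed.

(** Injectivity on every interval of n consecutive indices, which allows arcs to start
anywhere. *)
Lemma walk_inj n c i k l :
  closed_walk n c -> i <= k < i + n -> i <= l < i + n -> c k = c l -> k = l.
Proof.
move=> cw; wlog kl : k l / k <= l => [H|].
  case: (leqP k l) => [kl|/ltnW lk] hk hl E; first exact: H.
  by apply/esym; apply: H.
move=> /andP[ik kn] /andP[il ln] /(walk_eq cw) /eqP.
rewrite eq_sym eqn_mod_dvd // => /dvdnP[[|t] E]; first by lia.
by rewrite mulSn in E; lia.
Qed.

Lemma walk_path n c i m : closed_walk n c -> path (@adj G) (c i) [seq c k | k <- iota i.+1 m].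
Proof. by case=> _ _ _ ca; elim: m i => [|m IH] i //=; rewrite ca IH. Qed.

Definition is_cycle (s : seq G) := [&& 2 < size s, uniq s & cycle (@adj G) s].

Variable K : {set G}.
Hypothesis Kcl : forall a b, a \in K -> adj a b -> b \in K.

Lemma path_in_K a p : a \in K -> path (@adj G) a p -> all (mem K) p.
Proof. by elim: p a => [|b p IH] a //= aK /andP[ab /IH ->]; rewrite ?(Kcl aK ab). Qed.

Section Shortest.
Variables (n : nat) (c : nat -> G).
Hypothesis cw : closed_walk n c.
Hypothesis cK : forall i, c i \in K.
Hypothesis shortest : forall s, is_cycle s -> all (mem K) s -> n <= size s.

(** An arc from c_i to c_(i+m) and a path back through q, which avoids the cycle,
form a cycle again, which is not shorter than a shortest one. *)
Lemma ear_bound i m q : m < n -> uniq q -> (forall a j, a \in q -> a != c j) ->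
  path (@adj G) (c (i + m)) (rcons q (c i)) -> 2 < m.+1 + size q -> n <= m.+1 + size q.
Proof.
move=> mn uq qc pq big.
have sE : size ([seq c k | k <- iota i m.+1] ++ q) = m.+1 + size q.
  by rewrite size_cat size_map size_iota.
rewrite -sE; apply: shortest; last first.
  rewrite all_cat; apply/andP; split; first by apply/allP => a /mapP[k _ ->]; apply: cK.
  by have := path_in_K (cK _) pq; rewrite all_rcons => /andP[].
have us : uniq ([seq c k | k <- iota i m.+1] ++ q).
  rewrite cat_uniq uq andbT; apply/andP; split.
    rewrite map_inj_in_uniq ?iota_uniq // => k l; rewrite !mem_iota => hk hl.
    by apply: (walk_inj (i := i) cw); lia.
  apply/hasPn => a aq; apply/mapP => -[k _ E].
  by have := qc a k aq; rewrite E eqxx.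
rewrite /is_cycle sE big us /= rcons_cat cat_path (walk_path _ _ cw) /=.
suff -> : last (c i) [seq c k | k <- iota i.+1 m] = c (i + m) by [].
rewrite (last_map c); congr c.
by elim: (m) (i) => [|m' IH] j /=; rewrite ?addn0 // IH addSnnS.
Qed.

Lemma no_triangle a b e : 3 < n -> a \in K -> adj a b -> adj b e -> adj e a -> False.
Proof.
move=> n4 aK ab be ea.
have : n <= size [:: a; b; e]; last by rewrite leqNgt n4.
apply: shortest; last by rewrite /= aK (Kcl aK ab) (Kcl (Kcl aK ab) be).
have ne (p q : G) : adj p q -> (p == q) = false.
  by move=> pq; apply/eqP => E; rewrite E adj_irrefl in pq.
by rewrite /is_cycle /= ab be ea !inE (ne _ _ ab) (ne _ _ be) eq_sym (ne _ _ ea).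
Qed.

Lemma shortest_chordless i j : i < j < n -> adj (c i) (c j) -> c j = c i.+1 \/ c i = c j.+1.
Proof.
move=> /andP[ij jn] aij; have [->|ji] := eqVneq j i.+1; first by left.
right; have H : n <= (j - i).+1 + 0.
  apply: (@ear_bound i (j - i) [::]) => //=; try lia.
  by rewrite subnKC ?(ltnW ij) // adj_sym aij.
have [_ cn _ _] := cw; have [-> ->] : i = 0 /\ j.+1 = n by lia.
by rewrite -[n]add0n cn.
Qed.

Variable x : nat -> G.
Hypothesis sp : spoked n c x.

(** The two arcs between c_i and c_j have n edges together, and each of them becomes a cycle with
two more edges through the common end; so n <= 4 otherwise. *)
Lemma spoke_not_shared i j : 4 < n -> i < n -> j < n -> x i == x j -> i == j.
Proof.
move=> n5; wlog ij : i j / i < j => [H i_n j_n xx|i_n j_n /eqP xx].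
  case: (ltngtP i j) => // [ij|ji]; first by have := H i j ij i_n j_n xx; rewrite ltn_eqF.
  by have := H j i ji j_n i_n; rewrite eq_sym => /(_ xx); rewrite ltn_eqF.
have out a k : a \in [:: x i] -> a != c k by rewrite inE => /eqP ->; apply: sp_out sp _ _.
have [_ cn _ _] := cw.
have h1 : n <= (j - i).+1 + 1.
  apply: (@ear_bound i (j - i) [:: x i]) => //=; try lia.
  by rewrite subnKC ?(ltnW ij) //= {1}xx (adj_spoke sp) // adj_sym (adj_spoke sp).
have h2 : n <= (n - (j - i)).+1 + 1.
  apply: (@ear_bound j (n - (j - i)) [:: x i]) => //=; try lia.
  rewrite (_ : j + _ = i + n); last by lia.
  by rewrite cn /= (adj_spoke sp) //= xx adj_sym (adj_spoke sp).
by lia.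
Qed.

(** Likewise with three more edges, through both outer ends. Hence n <= 6, and for n = 6
the spokes are opposite. *)
Lemma spoke_link_bound i j : i < j < n -> adj (x i) (x j) -> n <= j - i + 3 /\ j - i <= 3.
Proof.
move=> /andP[ij jn] xx; have [_ cn _ _] := cw.
have ne : x i != x j by apply: contraTneq xx => ->; rewrite adj_irrefl.
have out a k : a \in [:: x i; x j] -> a != c k.
  by rewrite !inE => /orP[] /eqP ->; apply: sp_out sp _ _.
split.
  suff : n <= (j - i).+1 + 2 by lia.
  apply: (@ear_bound i (j - i) [:: x j; x i]) => //=; try lia.
  - by rewrite /= inE eq_sym ne.
  - by move=> a k; rewrite !inE orbC => ha; apply: out; rewrite !inE.
  - by rewrite subnKC ?(ltnW ij) //= (adj_spoke sp) // adj_sym xx adj_sym (adj_spoke sp).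
suff : n <= (n - (j - i)).+1 + 2 by lia.
apply: (@ear_bound j (n - (j - i)) [:: x i; x j]) => //=; try lia.
- by rewrite /= inE ne.
- rewrite (_ : j + _ = i + n); last by lia.
  by rewrite cn /= (adj_spoke sp) //= xx adj_sym (adj_spoke sp).
Qed.
End Shortest.

Lemma chordless_wlog n c : closed_walk n c ->
  (forall i j, i < j < n -> adj (c i) (c j) -> c j = c i.+1 \/ c i = c j.+1) ->
  forall i j, adj (c i) (c j) -> c j = c i.+1 \/ c i = c j.+1.
Proof.
move=> cw H i j; have [n3 cn _ _] := cw.
have sm k : c k.+1 = c (k %% n).+1.
  by rewrite (periodic_mod k.+1 cn) (periodic_mod (k %% n).+1 cn) -addn1 -modnDml addn1.
rewrite (periodic_mod i cn) (periodic_mod j cn) (sm i) (sm j).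
have i_n : i %% n < n by rewrite ltn_mod; lia.
have j_n : j %% n < n by rewrite ltn_mod; lia.
case: (ltngtP (i %% n) (j %% n)) => [ij|ji|->]; last by rewrite adj_irrefl.
  by apply: H; rewrite ij.
by rewrite adj_sym => /H; rewrite ji i_n => /(_ isT) []; [right|left].
Qed.

Lemma walk_of_cycle s a0 : is_cycle s -> closed_walk (size s) (fun i => nth a0 s (i %% size s)).
Proof.
case/and3P=> s3 us cs; split=> //.
- by move=> i; rewrite modnDr.
- move=> i j i_s j_s; rewrite !modn_small // => /eqP; rewrite nth_uniq //.
  by move/eqP.
move=> i; have i_s : i %% size s < size s by rewrite ltn_mod; lia.
have sm : i.+1 %% size s = (i %% size s).+1 %% size s by rewrite -addn1 -[in RHS]addn1 modnDml.
rewrite sm; move: (i %% size s) i_s {sm} => k i_s.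
have := next_cycle cs (mem_nth a0 i_s); rewrite next_nth mem_nth // index_uniq //.
case: s s3 us cs i_s => [|b s] //= s3 us cs i_s.
suff -> : nth b s k = nth a0 (b :: s) (k.+1 %% (size s).+1) by [].
case: (eqVneq k (size s)) => [->|ne]; first by rewrite modnn nth_default.
rewrite modn_small /=; last by lia.
by apply: set_nth_default; lia.
Qed.

(** All neighbours of the first vertex a of a longest path are on the path, since it cannot
be extended. One of them, y, is not the second vertex, and the path from a to y
closes to a cycle. *)
Lemma cycle_exists v0 : v0 \in K -> exists2 s, is_cycle s & all (mem K) s.
Proof.
move=> v0K.
pose P m := [exists p : m.-tuple G, exists a, [&& a \in K, path (@adj G) a p & uniq (a :: p)]].
have P0 : exists m, P m.
  by exists 0; apply/existsP; exists [tuple]; apply/existsP; exists v0; rewrite v0K.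
have Pm m : P m -> m <= #|G|.
  case/existsP=> p /existsP[a /and3P[_ _ up]].
  have := card_uniqP up; rewrite /= size_tuple => E; apply: ltnW; rewrite -E; exact: max_card.
case: (ex_maxnP P0 Pm) => m /existsP[p /existsP[a /and3P[aK pp up]]] mmax.
have nbp y : adj a y -> y \in (p : seq G).
  move=> ay; apply: contraT => yp.
  suff /mmax : P m.+1 by rewrite ltnn.
  apply/existsP; exists (cons_tuple a p); apply/existsP; exists y; rewrite (Kcl aK ay) /=.
  rewrite adj_sym ay pp /= inE negb_or yp andbT; move: up => /= -> /=.
  by rewrite andbT; apply: contraTneq ay => ->; rewrite adj_irrefl.
have [y ay yh] : exists2 y, adj a y & y != head a p.
  have : 0 < #|nb a :\ head a p|.
    by have := cardsD1 (head a p) (nb a); rewrite card_nb //; case: (_ \in _) => /=; lia.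
  by case/card_gt0P=> y; rewrite !inE => /andP[yh ay]; exists y.
have yp := nbp y ay; move: pp up yh.
case/splitPr: {p nbp} (tval p) / yp => p1 p2; rewrite cat_path => /andP[pp1 /andP[ly pp2]].
case: p1 pp1 ly => [|b p1]; first by rewrite /= eqxx.
move=> pp1 ly up _; exists (a :: rcons (b :: p1) y).
  rewrite /is_cycle; apply/and3P; split; first by rewrite /= size_rcons.
    by move: up; rewrite -cat_rcons -!cat_cons cat_uniq => /andP[].
  by rewrite /cycle !rcons_path last_rcons pp1 ly adj_sym ay.
have al : all (mem K) (rcons (b :: p1) y).
  by apply: (@path_in_K a) => //; rewrite rcons_path pp1.
by apply/andP; split.
Qed.
End Cycles.

(** * Choosing the rim *)
Section Component.
Variable G : sgraph.
Hypothesis cubG : cubic G.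

Section Choice.
Variable K : {set G}.
Hypothesis Kcl : forall a b, a \in K -> adj a b -> b \in K.

Lemma shortest_walk v0 : v0 \in K -> exists n c,
  [/\ closed_walk n c, forall i, c i \in K &
      forall s : seq G, is_cycle s -> all (mem K) s -> n <= size s].
Proof.
move=> v0K; pose P n := [exists s : n.-tuple G, is_cycle s && all (mem K) s].
have P0 : exists n, P n.
  have [s sc sK] := cycle_exists cubG Kcl v0K.
  by exists (size s); apply/existsP; exists (in_tuple s); rewrite sc.
case: (ex_minnP P0) => n /existsP[s /andP[sc sK]] nmin.
exists n, (fun i => nth v0 s (i %% n)); split.
- by have := walk_of_cycle v0 sc; rewrite size_tuple.
- move=> i; apply: (allP sK); rewrite mem_nth // size_tuple ltn_mod.
  by case/and3P: sc; rewrite size_tuple; lia.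
- by move=> t tc tK; apply: nmin; apply/existsP; exists (in_tuple t); rewrite tc.
Qed.

Definition spokes_choosable n (x : nat -> G) :=
  choosable (2 * n) (clash n (fun i j => x i == x j) (fun i j => adj (x i) (x j)))
    (room n (fun i j => x i == x j) (fun i j => adj (x i) (x j))).

Definition triangle_free := forall a b e, a \in K -> adj a b -> adj b e -> adj e a -> False.

(** Otherwise the common end makes a triangle with the two rim vertices. *)
Lemma spokes_differ n c x i :
  triangle_free -> (forall k, c k \in K) -> spoked n c x -> x i.+1 != x i.
Proof.
move=> tf cK sp; apply/eqP => E; apply: (tf (c i) (c i.+1) (x i)) => //.
- exact: adj_next sp i.
- by rewrite -E; apply: adj_spoke sp _.
- by rewrite adj_sym; apply: adj_spoke sp _.
Qed.

(** Any chord of a 5-cycle cuts off a triangle. *)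
Lemma five_chordless c i j : triangle_free -> (forall k, c k \in K) -> closed_walk 5 c ->
  i < j < 5 -> adj (c i) (c j) -> c j = c i.+1 \/ c i = c j.+1.
Proof.
move=> tf cK cw /andP[ij j5] aij; have [_ c5 _ ca] := cw.
have : [|| j == i.+1, j == i.+2, j == i.+3 | (j == 4) && (i == 0)] by lia.
case/or4P=> [/eqP ->|/eqP E|/eqP E|/andP[/eqP -> /eqP ->]]; first by left.
- by case: (tf (c i) (c i.+1) (c j)) => //; rewrite ?E // -E adj_sym.
- case: (tf (c j) (c j.+1) (c j.+2)) => //.
  by rewrite (_ : j.+2 = i + 5) ?c5 //; lia.
- by right; rewrite -(c5 0).
Qed.

(** The 5-cycle is c_i, c_(i+1), c_(i+2), x_(i+2), x_i. The fourth vertex c_(i+3) of the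
old rim is adjacent to c_i and c_(i+2), so it is the common end of the
spokes 0 and 2, as [choosable5_merged] requires. *)
Lemma five_cycle c x i :
  triangle_free -> (forall k, c k \in K) -> closed_walk 4 c -> spoked 4 c x ->
  adj (x i) (x i.+2) ->
  exists n c x, [/\ spoked n c x, forall i, c i \in K & spokes_choosable n x].
Proof.
move=> tf cK cw sp xx; have [_ c4 _ ca] := cw.
have xK k : x k \in K by apply: Kcl (adj_spoke sp k).
pose s := [:: c i; c i.+1; c i.+2; x i.+2; x i].
have cc m k : 0 < m < 4 -> (c k == c (m + k)) = false.
  move=> m4; apply/eqP => E; suff : k = m + k by lia.
  by apply: (walk_inj (i := k) cw) E; lia.
have c01 : (c i == c i.+1) = false := cc 1 i isT.
have c02 : (c i == c i.+2) = false := cc 2 i isT.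
have c12 : (c i.+1 == c i.+2) = false := cc 1 i.+1 isT.
have c13 : (c i.+1 == c i.+3) = false := cc 2 i.+1 isT.
have xc k l : (x k == c l) = false by apply/negbTE; apply: (sp_out sp).
have xne : (x i.+2 == x i) = false by apply: contraTF xx => /eqP ->; rewrite adj_irrefl.
have sc : is_cycle s.
  rewrite /is_cycle /= !inE c01 c02 c12 xne.
  rewrite ![c _ == x _]eq_sym !xc /= !ca (adj_spoke sp) [adj (x i.+2) _]adj_sym xx.
  by rewrite [adj (x i) _]adj_sym (adj_spoke sp).
have cw' := walk_of_cycle (c 0) sc; set c' := (fun _ => _) in cw'.
have c'K k : c' k \in K.
  have : all (mem K) s by rewrite /= !cK !xK.
  by move/allP; apply; rewrite mem_nth // ltn_mod.
have [x' sp'] := spokes_exist cubG cw' (chordless_wlog cw' (fun k l => five_chordless tf c'K cw')).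
exists 5, c', x'; split=> //.
have c03 : adj (c i) (c i.+3) by rewrite adj_sym -(c4 i) addnS addn3 ca.
apply: choosable5_merged.
- by move=> k l; apply: adj_sym.
- exact: adj_irrefl.
- by move=> k; apply: spokes_differ sp'.
- by move=> k; apply: (sp_spokes sp').
- have E0 := nb_cycle sp' 0 (c i.+3); have E2 := nb_cycle sp' 2 (c i.+3).
  have n1 : (c i.+3 == c i.+1) = false by rewrite eq_sym.
  have nx k : (c i.+3 == x k) = false by rewrite eq_sym xc.
  rewrite /c' /= c03 n1 nx in E0; rewrite /c' /= ca n1 nx in E2.
  by move/esym/eqP: E0 => <-; move/esym/eqP: E2 => <-.
Qed.

Lemma choosable_rim_exists v0 : v0 \in K ->
  exists n c x, [/\ spoked n c x, forall i, c i \in K & spokes_choosable n x].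
Proof.
move=> v0K; have [n [c [cw cK short]]] := shortest_walk v0K.
have [n3 cn _ ca] := cw.
have [x sp] := spokes_exist cubG cw (chordless_wlog cw (shortest_chordless Kcl cw cK short)).
have same i j : 4 < n -> i < n -> j < n -> x i == x j -> i == j.
  exact: (spoke_not_shared Kcl cw cK short sp).
have link i j : i < j < n -> adj (x i) (x j) -> n <= j - i + 3 /\ j - i <= 3.
  exact: (spoke_link_bound Kcl cw cK short sp).
have [n4|n4] := eqVneq n 4.
  subst n; have tf : triangle_free by move=> a b e; apply: (no_triangle Kcl short).
  case: (boolP [exists i : 'I_4, adj (x i) (x i.+2)]) => [/existsP[i]|/existsPn none].
    exact: five_cycle.
  exists 4, c, x; split=> //; apply: choosable4.
  - by move=> a b; apply: adj_sym.
  - by move=> i; apply: spokes_differ sp.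
  - exact: sp_spokes sp.
  - move=> i; have := none (Ordinal (ltn_pmod i (isT : 0 < 4))).
    rewrite /= -(spoke_mod sp) (spoke_mod sp (i %% 4).+2) -[(i %% 4).+2]addn2 modnDml addn2.
    by rewrite -(spoke_mod sp).
exists n, c, x; split=> //.
have [n5|n5] := leqP n 4.
  by have -> : n = 3 by [lia]; apply: choosable3.
have adT i j : i < n -> j < n -> adj (x i) (x j) ->
    (i < j /\ n <= j - i + 3 /\ j - i <= 3) \/ (j < i /\ n <= i - j + 3 /\ i - j <= 3).
  move=> i_n j_n; case: (ltngtP i j) => [ij|ji|->]; last by rewrite adj_irrefl.
    by move=> /link; rewrite ij j_n => /(_ isT); left.
  by rewrite adj_sym => /link; rewrite ji i_n => /(_ isT); right.
have {}same i j : i < n -> j < n -> x i == x j -> i == j by apply: same.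
rewrite /spokes_choosable; have [n6|n6] := leqP 7 n.
  apply: choosable_long => // i j i_n j_n.
    by apply/idP/idP => [/same->|/eqP ->].
  by move=> /(adT _ _ i_n j_n); lia.
have [E|E] := eqVneq n 6; first subst n.
  apply: choosable6 => // i j i_n j_n /(adT _ _ i_n j_n) H.
  apply/orP; right; case: H => -[_ [h1 h2]].
    by have -> : j = i + 3 by lia.
  by have -> : i = j + 3 by [lia]; rewrite -addnA modnDr.
have E5 : n = 5 by lia.
by subst n; apply: choosable5 => // a b; apply: adj_sym.
Qed.
End Choice.

(** The length of a shortest path to R. *)
Lemma distance_exists (K R : {set G}) :
  (forall a, a \in K -> exists2 r, r \in R & connect (@adj G) a r) ->
  (forall a b, a \in K -> adj a b -> b \in K) ->
  exists d : G -> nat, forall a, a \in K -> a \notin R -> exists2 w, adj a w & d w < d a.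
Proof.
move=> KR Kcl; pose P a m := [exists p : m.-tuple G, path (@adj G) a p && (last a p \in R)].
have dE (a : G) : exists m, a \in K -> P a m /\ forall m', P a m' -> m <= m'.
  case: (boolP (a \in K)) => [aK|_]; last by exists 0.
  have Pex : exists m, P a m.
    have [r rR /connectP[p pp rE]] := KR a aK.
    by exists (size p); apply/existsP; exists (in_tuple p); rewrite pp -rE.
  by case: (ex_minnP Pex) => m Pm mmin; exists m.
have [d dP] := fin_all_exists dE; exists d => a aK aR.
have [/existsP[p pP] _] := dP a aK.
case: p pP => -[|w p] /= sp; first by rewrite (negPf aR).
case/andP=> /andP[aw pp] lp; exists w => //; have [_ dmin] := dP w (Kcl _ _ aK aw).
rewrite -(eqP sp) ltnS; apply: dmin; apply/existsP; exists (in_tuple p); rewrite /= pp lp //.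
Qed.

Lemma connect_adj_sym : connect_sym (@adj G).
Proof. by apply: sym_connect_sym; apply: adj_sym. Qed.

Variables (C : choiceType) (L : edge G -> {fset C}).
Hypothesis L10 : forall e, 10 <= #|` L e|%fset.

Lemma color_connected v0 :
  exists phi, strong_on L [set e : edge G | val e \subset [set v | connect (@adj G) v0 v]] phi.
Proof.
set K := [set v | _].
have Kcl a b : a \in K -> adj a b -> b \in K.
  by rewrite !inE => v0a ab; apply: connect_trans v0a (connect1 ab).
have v0K : v0 \in K by rewrite inE connect0.
have [n [c [x [sp cK chs]]]] := choosable_rim_exists Kcl v0K.
have [|d dP] := @distance_exists K (rim n c) _ Kcl.
  move=> a; rewrite inE => v0a; exists (c 0); first exact: cycle_in_rim sp _.
  apply: (@connect_trans _ _ v0); last by have := cK 0; rewrite inE.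
  by rewrite connect_adj_sym.
exact: (color_component cubG sp L10 dP chs).
Qed.

(** * The normal colouring *)

(** An edge is coloured as in the component of its ends, named by its root; conflicting edges
lie in the same component. *)
Lemma strong_coloring : exists phi, strong_on L setT phi.
Proof.
have [phi phiP] := fin_all_exists color_connected.
have ex_end (e : edge G) : exists u, u \in val e.
  by have [u [v [_ ->]]] := edgeP e; exists u; rewrite !inE eqxx.
have [u uP] := fin_all_exists ex_end.
pose base (e : edge G) := fingraph.root (@adj G) (u e).
have baseP (e : edge G) a : a \in val e -> fingraph.root (@adj G) a = base e.
  move=> ae; apply/eqP; rewrite (root_connect connect_adj_sym).
  have [b ab eE] := edge_memP ae; have := uP e; rewrite eE !inE.
  by case/orP=> /eqP ->; rewrite ?connect0 // connect1.
have in_comp (e : edge G) : val e \subset [set v | connect (@adj G) (base e) v].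
  apply/subsetP => a /baseP <-; rewrite inE connect_adj_sym; exact: connect_root.
exists (fun e => phi (base e) e); split=> [e|e f _ _ ef]; first by have [] := phiP (base e).
have bE : base e = base f.
  case/andP: ef => _ /exists_inP[a ae /exists_inP[b bf ab]].
  rewrite -(baseP _ _ ae) -(baseP _ _ bf); apply/eqP; rewrite (root_connect connect_adj_sym).
  by case/orP: ab => [/eqP ->|/connect1].
have [_ phiE] := phiP (base e); rewrite -bE; apply: phiE => //; rewrite inE ?in_comp //.
by rewrite bE in_comp.
Qed.

(** The four edges adjacent to uv are pairwise in conflict, since each has u or v as an end. *)
Lemma strong_normal phi : strong_on L setT phi -> normal_edge_coloring phi.
Proof.
case=> _ pE; split=> [e f /andP[ef ne]|e].
  apply: pE; rewrite ?inE // /conflict ef /=.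
  have /set0Pn[a] := ne; rewrite inE => /andP[ae af].
  by apply/exists_inP; exists a => //; apply/exists_inP; exists a; rewrite // /touch eqxx.
apply/orP; left; rewrite /rich /adjacent_colors.
have [u [v [uv eE]]] := edgeP e.
set S := [set f | edge_adjacent e f]%SET.
have SE : S = (inc u :|: inc v) :\ e.
  apply/setP => f; rewrite !inE /edge_adjacent eq_sym eE; congr (_ && _).
  apply/set0Pn/orP => [[a]|[] af].
  - by rewrite !inE => /andP[/orP[] /eqP ->]; [left|right].
  - by exists u; rewrite !inE eqxx.
  - by exists v; rewrite !inE eqxx orbT.
have cardS : #|S| = 4.
  have := cardsD1 e (inc u :|: inc v); rewrite -SE cardsU !card_inc //.
  have -> : inc u :&: inc v = [set e].
    apply/setP => f; rewrite !inE; apply/andP/eqP => [[uf vf]|->];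
      last by rewrite eE !inE !eqxx orbT.
    have [w uw fE] := edge_memP uf; apply: val_inj; rewrite /= eE fE.
    by move: vf; rewrite fE !inE => /orP[] /eqP E; [rewrite E adj_irrefl in uv|rewrite E].
  by rewrite cards1 !inE eE !inE eqxx /= => -[].
rewrite card_in_imfset => [|f g fS gS fg]; first by rewrite (size_enum_finmem (S := S)) ?cardS.
apply: contra_eq fg => fg; apply: pE; rewrite ?inE // /conflict fg /=.
have endS h : h \in S -> exists2 a, a \in val h & (a == u) || (a == v).
  by rewrite SE !inE => /andP[_ /orP[] ah]; [exists u|exists v]; rewrite ?eqxx ?orbT.
have [a af aE] := endS f fS; have [b bg bE] := endS g gS.
apply/exists_inP; exists a => //; apply/exists_inP; exists b => //; rewrite /touch.
by case/orP: aE => /eqP ->; case/orP: bE => /eqP ->; rewrite ?eqxx // ?uv ?orbT // adj_sym uv orbT.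
Qed.
End Component.

Lemma least_exists (P : nat -> Prop) m :
  P m -> exists k, (P k /\ forall j, P j -> k <= j) /\ k <= m.
Proof.
elim/ltn_ind: m => m IH Pm; case: (classic (exists j, j < m /\ P j)) => [[j [jm Pj]]|none].
  by have [k [kP kj]] := IH j jm Pj; exists k; split=> //; apply: leq_trans kj (ltnW jm).
exists m; split=> //; split=> // j Pj; case: (leqP m j) => // jm.
by case: none; exists j.
Qed.

Theorem corollary1p9 :
  forall G : sgraph, cubic G ->
  exists k : nat, is_list_normal_chromatic_index G k /\ k <= 10.
Proof.
move=> G cubG; apply: least_exists => C L L10.
have [phi phiP] := strong_coloring cubG L10.
by exists phi; split; [exact: strong_normal phiP | case: phiP].
Qed.
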